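(* Let $\lambda_1,\lambda_2\in\mathbb{C}$ be such that $\lambda_1,\lambda_2,\lambda_1+\lambda_2\notin\frac12\mathbb{Z}_{\ge0}$, let $J\in\mathbb{Z}_{\ge 0}$ and $\lambda=\lambda_1+\lambda_2-J$. Let $\psi_\lambda:M_\lambda\hookrightarrow M_{\lambda_1}\otimes M_{\lambda_2}$ be the $U_q(\mathfrak{sl}_2)$-module embedding normalized by $(\psi_\lambda(e^\lambda_\lambda),\psi_\lambda(e^\lambda_\lambda))=1$ (this determines $\psi_\lambda$ up to sign), and define the $q3j$-symbols by $$\psi_\lambda(e^\lambda_a)=\sum_{a_1+a_2=a}\begin{bmatrix}\lambda_1&\lambda_2&\lambda\\ a_1&a_2&a\end{bmatrix}^\psi_q e^{\lambda_1}_{a_1}\otimes e^{\lambda_2}_{a_2},\qquad a_j\in\lambda_j-\mathbb{Z}_{\ge0}.$$ Then, with the sign of $\psi_\lambda$ matched to the choice of the square root in $$\Delta(\lambda_1,\lambda_2,\lambda)=\Big([\lambda_1+\lambda_2-\lambda]_q!\prod_{j=0}^{\lambda_1+\lambda_2-\lambda-1}\frac{[2\lambda_1-j]_q[2\lambda_2-j]_q}{[2\lambda+2+j]_q}\Big)^{1/2},$$ the following formulas hold for all $a\in\lambda-\mathbb{Z}_{\ge0}$ and $a_j\in\lambda_j-\mathbb{Z}_{\ge0}$ with $a_1+a_2=a$. (Racah--Fock formula) $$\begin{bmatrix}\lambda_1&\lambda_2&\lambda\\ a_1&a_2&a\end{bmatrix}^\psi_q=(-1)^{\frac J2+\lambda_1-a_1}q^{(\lambda_2^2-a_2^2)-(\lambda^2-a^2)-(\lambda_1-a_1)}\frac{[\lambda-a]_q!}{\prod_{j=1}^{\lambda-a}[\lambda+a+j]_q}\,\Delta(\lambda_1,\lambda_2,\lambda)$$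 $$\times\sum_{z,w}(-1)^zq^{z(\lambda+a+1)}\frac{\prod_{j=1}^z[\lambda_1+a_1+j]_q\prod_{j=1}^w[\lambda_2+a_2+j]_q}{[z]_q![w]_q![\lambda_1-a_1-z]_q![\lambda_2-a_2-w]_q!},$$ where the sum is over $(z,w)\in\mathbb{Z}_{\ge0}^2$ with $z+w=\lambda-a$. (Van der Waerden formula) $$\begin{bmatrix}\lambda_1&\lambda_2&\lambda\\ a_1&a_2&a\end{bmatrix}^\psi_q=(-1)^{\frac J2}q^{\lambda_1^2+\lambda_2^2-\lambda^2+\lambda_1\lambda_2+a_1a_2+\lambda_1a_2-\lambda_2a_1}\frac{[\lambda-a]_q!}{\prod_{j=1}^{\lambda-a}[\lambda+a+j]_q}\,\Delta(\lambda_1,\lambda_2,\lambda)$$ $$\times\sum_{z,w}(-1)^zq^{-z(\lambda_1+\lambda_2+\lambda+1)}\frac{[\lambda_2-\lambda_1+\lambda\,|\,\lambda_2+a_2-z]_q\,[\lambda_1-\lambda_2+\lambda\,|\,\lambda_1+a_1-w]_q}{[z]_q![w]_q![\lambda_1-a_1-z]_q![\lambda_2-a_2-w]_q!},$$ where the sum is over $(z,w)\in\mathbb{Z}_{\ge0}^2$ with $z+w=J$.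
   Context: Notation: $q=e^{h/2}$ with $h\in\mathbb{C}$, $q^x:=e^{hx/2}$, $[x]_q=\frac{q^x-q^{-x}}{q-q^{-1}}$ for $x\in\mathbb{C}$, $[n]_q!=\prod_{s=1}^n[s]_q$, $[0]_q!=1$, $(-1)^{J/2}:=e^{i\pi J/2}$. The parameter $q$ is generic: $[x]_q\neq0$ for every nonzero $x\in\mathbb{Z}+2\mathbb{Z}\lambda_1+2\mathbb{Z}\lambda_2$. Terms in a sum containing $[n]_q!$ with a negative integer $n$ in the denominator are omitted (read as $0$), and empty products equal $1$. For $a-b\in\mathbb{Z}$ put $[a|b]_q=\prod_{j=1}^{a-b}[b+j]_q$ if $a>b$ (i.e. $a-b>0$), $[a|b]_q=1/\prod_{j=1}^{b-a}[a+j]_q$ if $a-b<0$, and $[a|a]_q=1$. $U_q(\mathfrak{sl}_2)$ is the Hopf algebra generated by $E,F,K^{\pm1}$ with $KE=q^2EK$, $KF=q^{-2}FK$, $[E,F]=\frac{K-K^{-1}}{q-q^{-1}}$, and coproduct $\Delta E=E\otimes K+1\otimes E$, $\Delta F=F\otimes1+K^{-1}\otimes F$, $\Delta K^{\pm1}=K^{\pm1}\otimes K^{\pm1}$ (used to define tensor products of modules). For $\lambda\in\mathbb{C}\setminus\frac12\mathbb{Z}_{\ge0}$, the Verma module $M_\lambda$ has basis $e^\lambda_a$, $a\in\lambda-\mathbb{Z}_{\ge0}$, with $Ke^\lambda_a=q^{2a}e^\lambda_a$, $Ee^\lambda_a=[\lambda-a]_qe^\lambda_{a+1}$, $Fe^\lambda_a=[\lambda+a]_qe^\lambda_{a-1}$.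 Under the stated assumptions $M_{\lambda_1}\otimes M_{\lambda_2}=\bigoplus_{J\ge0}M_{\lambda_1+\lambda_2-J}$. The Shapovalov form on $M_\lambda$ is the bilinear form with $(e^\lambda_{\lambda-k},e^\lambda_{\lambda-k'})=\delta_{k,k'}\alpha_{\lambda,k}$, where $\alpha_{\lambda,k}=\frac{(-1)^kq^{k(k-2\lambda+1)}[k]_q!}{\prod_{j=0}^{k-1}[2\lambda-j]_q}$. It is extended to tensor products by $(x_1\otimes x_2,y_1\otimes y_2)=(x_1,y_1)(x_2,y_2)$. *)

(* Defs.v *)
From HB Require Import structures.
From mathcomp Require Import all_boot all_order all_algebra.
From mathcomp Require Import finmap monalg.
From mathcomp Require Import complex ring.
From mathcomp Require Import reals sequences exp trigo.

Set Implicit Arguments.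
Unset Strict Implicit.
Unset Printing Implicit Defensive.

Import Order.TTheory GRing.Theory Num.Theory.
Local Open Scope ring_scope.
Local Open Scope complex_scope.

Section QNumbers.
Variable R : realType.
Local Notation C := R[i].

Definition cexp (z : C) : C :=
  (expR (complex.Re z))%:C * (cos (complex.Im z) +i* sin (complex.Im z)).

Variable h : C.

Definition qpow (x : C) : C := cexp (h * x / 2%:R).

Definition qq : C := cexp (h / 2%:R).

Definition qnum (x : C) : C := (qpow x - qpow (- x)) / (qq - qq^-1).

Definition qfact (n : nat) : C := \prod_(1 <= s < n.+1) qnum s%:R.

(* [a|b]_q, meaningful when a - b is an integer, which the floor of its real
   part then recovers; Negz m stands for - (m + 1). *)
Definition qratio (a b : C) : C :=
  match Num.floor (complex.Re (a - b)) with
  | Posz m => \prod_(1 <= j < m.+1) qnum (b + j%:R)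
  | Negz m => (\prod_(1 <= j < m.+2) qnum (a + j%:R))^-1
  end.

(* (-1)^(J/2) = exp (i pi J / 2) *)
Definition sign_half (J : nat) : C := cexp (0 +i* (pi * J%:R / 2%:R)).

(* Genericity of q.  In particular [1]_q != 0, so q != q^-1 although division
   by 0 is total. *)
Definition generic (l1 l2 : C) : Prop :=
  forall n m1 m2 : int,
    let x := n%:~R + 2%:R * m1%:~R * l1 + 2%:R * m2%:~R * l2 in
    x != 0 -> qnum x != 0.

Lemma cexpD x y : cexp (x + y) = cexp x * cexp y.
Proof.
case: x y => [a b] [c d]; rewrite /cexp /= expRD sinD cosD.
by apply/eqP; rewrite eq_complex /=; apply/andP; split; apply/eqP; ring.
Qed.

Lemma cexp0 : cexp 0 = 1.
Proof.
rewrite /cexp /= expR0 sin0 cos0.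
by apply/eqP; rewrite eq_complex /=; apply/andP; split; apply/eqP; ring.
Qed.

Lemma qpowD x y : qpow (x + y) = qpow x * qpow y.
Proof. by rewrite /qpow -cexpD mulrDr mulrDl. Qed.

Lemma qpow0 : qpow 0 = 1.
Proof. by rewrite /qpow mulr0 mul0r cexp0. Qed.

Lemma qpow_neq0 x : qpow x != 0.
Proof.
have qxV : qpow x * qpow (- x) = 1 by rewrite -qpowD subrr qpow0.
by apply: contra_eq_neq qxV => ->; rewrite mul0r eq_sym oner_neq0.
Qed.

Lemma qpowN x : qpow (- x) = (qpow x)^-1.
Proof.
by apply: (mulfI (qpow_neq0 x)); rewrite -qpowD subrr qpow0 divff ?qpow_neq0.
Qed.

Lemma qpow1 : qpow 1 = qq.
Proof. by rewrite /qpow mulr1. Qed.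

Lemma qq_neq0 : qq != 0.
Proof. by rewrite -qpow1 qpow_neq0. Qed.

Lemma qpow2 : qpow 2%:R = qq ^+ 2.
Proof. by rewrite (natrD _ 1 1) qpowD qpow1. Qed.

Lemma qnum0 : qnum 0 = 0.
Proof. by rewrite /qnum oppr0 subrr mul0r. Qed.

End QNumbers.

(* {malg C[I]} is used only as the vector space of finitely supported functions
   I -> C: <<i>> is its i-th basis vector and v@_i the i-th coordinate of v. *)
Section FreeModules.
Variable C : fieldType.

Section LinearExtension.
Variables (I : choiceType) (W : lmodType C) (f : I -> W).

Definition linext (v : {malg C[I]}) : W := \sum_(i <- msupp v) v@_i *: f i.

Lemma linextEw (d : {fset I}) v :
  (msupp v `<=` d)%fset -> linext v = \sum_(i <- d) v@_i *: f i.
Proof.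
move=> sd; rewrite /linext (big_fset_incl _ sd) //= => i _ /mcoeff_outdom ->.
by rewrite scale0r.
Qed.

Lemma linext_is_linear : linear linext.
Proof.
move=> a u v.
pose d := (msupp (a *: u + v) `|` (msupp u `|` msupp v))%fset.
have su : (msupp u `<=` d)%fset by rewrite /d fsubsetU // fsubsetUl orbT.
have sv : (msupp v `<=` d)%fset by rewrite /d fsubsetU // fsubsetUr orbT.
rewrite (@linextEw d) ?fsubsetUl // (linextEw su) (linextEw sv).
rewrite scaler_sumr -big_split /=; apply: eq_bigr => i _.
by rewrite mcoeffD mcoeffZ scalerDl scalerA.
Qed.

HB.instance Definition _ :=
  GRing.isLinear.Build C {malg C[I]} W *:%R linext linext_is_linear.

Lemma linextU i : linext << i >> = f i.
Proof.
by rewrite (linextEw msuppU_le) big_seq_fset1 mcoeffUU scale1r.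
Qed.

End LinearExtension.

Lemma malg_linE (I : choiceType) (v : {malg C[I]}) :
  v = \sum_(i <- msupp v) v@_i *: << i >>.
Proof.
rewrite {1}[v]monalgE; apply: eq_bigr => i _.
by apply/malgP => k; rewrite mcoeffZ !mcoeffU mulrnAr mulr1.
Qed.

Lemma linear_ext (I : choiceType) (W : lmodType C)
    (f g : {linear {malg C[I]} -> W}) :
  (forall i, f << i >> = g << i >>) -> f =1 g.
Proof.
move=> fg v; rewrite [v]malg_linE !linear_sum; apply: eq_bigr => i _.
by rewrite !linearZ fg.
Qed.

Section Tensor.
Variables I J : choiceType.

(* The tensor product of {malg C[I]} and {malg C[J]} is modelled by
   {malg C[I * J]}, with <<(i, j)>> standing for <<i>> (x) <<j>>. *)
Definition tens (x : {malg C[I]}) (y : {malg C[J]}) : {malg C[(I * J)%type]} :=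
  linext (fun i => linext (fun j => << (i, j) >>) y) x.

Lemma tensUU i j : tens << i >> << j >> = << (i, j) >>.
Proof. by rewrite /tens !linextU. Qed.

Lemma tens_linearl y : linear (fun x => tens x y).
Proof. by move=> a u v; rewrite /tens linearP. Qed.

Lemma tens_linearr x : linear (tens x).
Proof.
move=> a u v; rewrite /tens /linext scaler_sumr -big_split /=.
apply: eq_bigr => i _; rewrite -!/(linext _ _) linearP scalerDr.
by rewrite !scalerA mulrC.
Qed.

HB.instance Definition _ x :=
  GRing.isLinear.Build C _ _ *:%R (tens x) (tens_linearr x).

Definition tensl (y : {malg C[J]}) (x : {malg C[I]}) := tens x y.
HB.instance Definition _ y :=
  GRing.isLinear.Build C _ _ *:%R (tensl y) (tens_linearl y).

End Tensor.

Section TensorOp.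
Variables I J I' J' : choiceType.
Variables (A : {linear {malg C[I]} -> {malg C[I']}}).
Variables (B : {linear {malg C[J]} -> {malg C[J']}}).

Definition tens_op : {malg C[(I * J)%type]} -> {malg C[(I' * J')%type]} :=
  linext (fun ij => tens (A << ij.1 >>) (B << ij.2 >>)).

HB.instance Definition _ := GRing.Linear.on tens_op.

Lemma tens_opU i j : tens_op << (i, j) >> = tens (A << i >>) (B << j >>).
Proof. by rewrite /tens_op linextU. Qed.

Lemma tens_opE x y : tens_op (tens x y) = tens (A x) (B y).
Proof.
rewrite -!/(tensl _ _).
apply: (@linear_ext _ _ (tens_op \o tensl y) (tensl (B y) \o A)) => i /=.
rewrite /tensl.
apply: (@linear_ext _ _ (tens_op \o tens _) (tens _ \o B)) => j /=.
by rewrite tensUU tens_opU.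
Qed.

End TensorOp.

Section Forms.

Definition bilext (I J : choiceType) (b : I -> J -> C)
    (x : {malg C[I]}) (y : {malg C[J]}) : C :=
  \sum_(i <- msupp x) \sum_(j <- msupp y) x@_i * y@_j * b i j.

Lemma bilextUU (I J : choiceType) (b : I -> J -> C) i j :
  bilext b << i >> << j >> = b i j.
Proof.
by rewrite /bilext !msuppU oner_eq0 !big_seq_fset1 !mcoeffUU !mul1r.
Qed.

Lemma bilextE (I J : choiceType) (b : I -> J -> C) x y :
  bilext b x y = linext (fun i => linext (b i : J -> C^o) y) x.
Proof.
rewrite /bilext /linext; apply: eq_bigr => i _; rewrite scaler_sumr.
by apply: eq_bigr => j _; rewrite /GRing.scale /= mulrA.
Qed.

Lemma bilext_linearl (I J : choiceType) (b : I -> J -> C) y :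
  linear ((fun x => bilext b x y) : {malg C[I]} -> C^o).
Proof. by move=> a u v; rewrite !bilextE linearP. Qed.

Lemma bilext_linearr (I J : choiceType) (b : I -> J -> C) x :
  linear (bilext b x : {malg C[J]} -> C^o).
Proof.
have flip y : bilext b x y = bilext (fun j i => b i j) y x.
  rewrite /bilext exchange_big; apply: eq_bigr => j _; apply: eq_bigr => i _.
  by rewrite [y@_j * _]mulrC.
by move=> a u v; rewrite !flip bilext_linearl.
Qed.

(* The bilinear form on the tensor product with
   (x1 (x) x2, y1 (x) y2) = (x1, y1) (x2, y2) on basis vectors. *)
Definition tens_form (I J : choiceType)
    (b : {malg C[I]} -> {malg C[I]} -> C)
    (b' : {malg C[J]} -> {malg C[J]} -> C) :
    {malg C[(I * J)%type]} -> {malg C[(I * J)%type]} -> C :=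
  bilext (fun ij kl => b << ij.1 >> << kl.1 >> * b' << ij.2 >> << kl.2 >>).

End Forms.

End FreeModules.

Section Uqsl2Modules.
Variables (C : fieldType) (q : C).

(* A U_q(sl_2)-module structure on V: operators by which the generators E, F,
   K, K^-1 act, subject to the defining relations. *)
Record uq_module (V : lmodType C) := UqModule {
  actE : {linear V -> V};
  actF : {linear V -> V};
  actK : {linear V -> V};
  actKV : {linear V -> V};
  actKKV : forall v, actK (actKV v) = v;
  actKVK : forall v, actKV (actK v) = v;
  actKE : forall v, actK (actE v) = q ^+ 2 *: actE (actK v);
  actKF : forall v, actK (actF v) = q ^- 2 *: actF (actK v);
  actEF : forall v,
    actE (actF v) - actF (actE v) = (q - q^-1)^-1 *: (actK v - actKV v)
}.

Definition uq_hom (V W : lmodType C) (MV : uq_module V) (MW : uq_module W)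
    (f : {linear V -> W}) : Prop :=
  forall v,
    [/\ f (actE MV v) = actE MW (f v), f (actF MV v) = actF MW (f v),
        f (actK MV v) = actK MW (f v) & f (actKV MV v) = actKV MW (f v)].

Section TensorModule.
Variables I J : choiceType.
Hypothesis q0 : q != 0.
Variables (M : uq_module {malg C[I]}) (N : uq_module {malg C[J]}).
Local Notation V := {malg C[(I * J)%type]}.

(* The generators act through the coproduct
   E -> E (x) K + 1 (x) E, F -> F (x) 1 + K^-1 (x) F, K^(+-1) -> K^(+-1) (x) K^(+-1). *)
Definition tensE : V -> V :=
  tens_op (actE M) (actK N) \+ tens_op idfun (actE N).
Definition tensF : V -> V :=
  tens_op (actF M) idfun \+ tens_op (actKV M) (actF N).
Definition tensK : V -> V := tens_op (actK M) (actK N).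
Definition tensKV : V -> V := tens_op (actKV M) (actKV N).

HB.instance Definition _ := GRing.Linear.on tensE.
HB.instance Definition _ := GRing.Linear.on tensF.
HB.instance Definition _ := GRing.Linear.on tensK.
HB.instance Definition _ := GRing.Linear.on tensKV.

Lemma tensEE x y :
  tensE (tens x y) = tens (actE M x) (actK N y) + tens x (actE N y).
Proof. by rewrite /tensE /= !tens_opE. Qed.
Lemma tensFE x y :
  tensF (tens x y) = tens (actF M x) y + tens (actKV M x) (actF N y).
Proof. by rewrite /tensF /= !tens_opE. Qed.
Lemma tensKE x y : tensK (tens x y) = tens (actK M x) (actK N y).
Proof. exact: tens_opE. Qed.
Lemma tensKVE x y : tensKV (tens x y) = tens (actKV M x) (actKV N y).
Proof. exact: tens_opE. Qed.

Lemma tens_ext (W : lmodType C) (f g : {linear V -> W}) :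
  (forall x y, f (tens x y) = g (tens x y)) -> f =1 g.
Proof. by move=> fg; apply: linear_ext => -[i j]; rewrite -tensUU. Qed.

Lemma tensZl (a : C) (x : {malg C[I]}) (y : {malg C[J]}) :
  tens (a *: x) y = a *: tens x y.
Proof. by rewrite -!/(tensl _ _) linearZ. Qed.
Lemma tensZr (a : C) (x : {malg C[I]}) (y : {malg C[J]}) :
  tens x (a *: y) = a *: tens x y.
Proof. by rewrite linearZ. Qed.
Lemma tensBl (x x' : {malg C[I]}) (y : {malg C[J]}) :
  tens (x - x') y = tens x y - tens x' y.
Proof. by rewrite -!/(tensl _ _) linearB. Qed.
Lemma tensBr (x : {malg C[I]}) (y y' : {malg C[J]}) :
  tens x (y - y') = tens x y - tens x y'.
Proof. by rewrite linearB. Qed.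

Lemma tensKKV v : tensK (tensKV v) = v.
Proof.
apply: (@tens_ext _ (tensK \o tensKV) idfun) => x y /=.
by rewrite tensKVE tensKE !actKKV.
Qed.

Lemma tensKVK v : tensKV (tensK v) = v.
Proof.
apply: (@tens_ext _ (tensKV \o tensK) idfun) => x y /=.
by rewrite tensKE tensKVE !actKVK.
Qed.

Lemma tensK_E v : tensK (tensE v) = q ^+ 2 *: tensE (tensK v).
Proof.
apply: (@tens_ext _ (tensK \o tensE) (q ^+ 2 \*: (tensE \o tensK))) => x y /=.
rewrite tensEE tensKE [tensK (_ + _)]linearD /= tensKE tensKE tensEE.
rewrite actKE actKE tensZl tensZr.
by rewrite -scalerDr.
Qed.

Lemma tensK_F v : tensK (tensF v) = q ^- 2 *: tensF (tensK v).
Proof.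
apply: (@tens_ext _ (tensK \o tensF) (q ^- 2 \*: (tensF \o tensK))) => x y /=.
rewrite tensFE tensKE [tensK (_ + _)]linearD /= tensKE tensKE tensFE.
rewrite actKF actKF tensZl tensZr.
by rewrite -scalerDr actKKV actKVK.
Qed.

Lemma tensE_F_aux (U : zmodType) (a b c d a' d' : U) :
  a + b + (c + d) - (a' + c + (b + d')) = (a - a') + (d - d').
Proof.
have -> : a + b + (c + d) = a + d + (c + b) by rewrite [c + d]addrC addrACA [b + c]addrC.
have -> : a' + c + (b + d') = a' + d' + (c + b) by rewrite [b + d']addrC addrACA.
by rewrite opprD addrACA subrr addr0 opprD addrACA.
Qed.

Lemma tensE_F v :
  tensE (tensF v) - tensF (tensE v) =
  (q - q^-1)^-1 *: (tensK v - tensKV v).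
Proof.
apply: (@tens_ext _ ((tensE \o tensF) \- (tensF \o tensE))
  ((q - q^-1)^-1 \*: (tensK \- tensKV))) => x y /=.
have EKV u : actE M (actKV M u) = q ^+ 2 *: actKV M (actE M u).
  by rewrite -{1}[u in LHS](actKVK M) -[LHS](actKVK M) actKE actKVK actKKV linearZ.
rewrite tensFE tensEE tensKE tensKVE [tensE (_ + _)]linearD [tensF (_ + _)]linearD /=.
rewrite tensEE tensEE tensFE tensFE EKV actKF tensZl tensZr scalerA.
rewrite mulfV ?expf_neq0 // scale1r.
rewrite tensE_F_aux -tensBl -tensBr actEF actEF.
by rewrite tensZl tensZr -scalerDr tensBl tensBr addrA subrK.
Qed.

Definition tens_module : uq_module V :=
  @UqModule _ tensE tensF tensK tensKV
    tensKKV tensKVK tensK_E tensK_F tensE_F.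

End TensorModule.

End Uqsl2Modules.

Section Modules.
Variables (R : realType) (h : R[i]).
Local Notation C := R[i].
Local Notation q := (qq h).

Section Verma.
Variable l : C.

(* The basis vector e_a of the Verma module M_l, a = l - k, is << k >>.
   The vector e_{l+1} in E e_l = [0]_q e_{l+1} does not exist; k.-1 is
   harmless there because [0]_q = 0. *)
Local Notation wt k := (l - k%:R).

Definition vermaE : {malg C[nat]} -> {malg C[nat]} :=
  linext (fun k : nat => qnum h (l - wt k) *: << k.-1 >>).
Definition vermaF : {malg C[nat]} -> {malg C[nat]} :=
  linext (fun k : nat => qnum h (l + wt k) *: << k.+1 >>).
Definition vermaK : {malg C[nat]} -> {malg C[nat]} :=
  linext (fun k : nat => qpow h (2%:R * wt k) *: << k >>).
Definition vermaKV : {malg C[nat]} -> {malg C[nat]} :=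
  linext (fun k : nat => (qpow h (2%:R * wt k))^-1 *: << k >>).

HB.instance Definition _ := GRing.Linear.on vermaE.
HB.instance Definition _ := GRing.Linear.on vermaF.
HB.instance Definition _ := GRing.Linear.on vermaK.
HB.instance Definition _ := GRing.Linear.on vermaKV.

Lemma vermaEU (k : nat) :
  vermaE << k >> = qnum h (l - wt k) *: << k.-1 >>.
Proof. exact: linextU. Qed.
Lemma vermaFU (k : nat) :
  vermaF << k >> = qnum h (l + wt k) *: << k.+1 >>.
Proof. exact: linextU. Qed.
Lemma vermaKU (k : nat) :
  vermaK << k >> = qpow h (2%:R * wt k) *: << k >>.
Proof. exact: linextU. Qed.
Lemma vermaKVU (k : nat) :
  vermaKV << k >> = (qpow h (2%:R * wt k))^-1 *: << k >>.
Proof. exact: linextU. Qed.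

Lemma vermaKKV v : vermaK (vermaKV v) = v.
Proof.
apply: (@linear_ext _ _ _ (vermaK \o vermaKV) idfun) => k /=.
by rewrite vermaKVU linearZ /= vermaKU scalerA mulVf ?qpow_neq0 ?scale1r.
Qed.

Lemma vermaKVK v : vermaKV (vermaK v) = v.
Proof.
apply: (@linear_ext _ _ _ (vermaKV \o vermaK) idfun) => k /=.
by rewrite vermaKU linearZ /= vermaKVU scalerA mulfV ?qpow_neq0 ?scale1r.
Qed.

Lemma vermaKE v : vermaK (vermaE v) = q ^+ 2 *: vermaE (vermaK v).
Proof.
apply: (@linear_ext _ _ _ (vermaK \o vermaE) (q ^+ 2 \*: (vermaE \o vermaK))).
move=> k /=.
rewrite vermaEU vermaKU !linearZ /= vermaKU vermaEU !scalerA; case: k => [|k].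
  by rewrite subr0 subrr qnum0 !(mulr0, mul0r) !scale0r.
congr (_ *: _); rewrite /= -qpow2 -qpowD mulrC; congr (qpow h _ * _).
by rewrite -natr1; ring.
Qed.

Lemma vermaKF v : vermaK (vermaF v) = q ^- 2 *: vermaF (vermaK v).
Proof.
apply: (@linear_ext _ _ _ (vermaK \o vermaF) (q ^- 2 \*: (vermaF \o vermaK))).
move=> k /=.
rewrite vermaFU vermaKU !linearZ /= vermaKU vermaFU !scalerA.
congr (_ *: _); rewrite -qpow2 -qpowN -qpowD mulrC; congr (qpow h _ * _).
by rewrite -natr1; ring.
Qed.

Lemma vermaEF v :
  vermaE (vermaF v) - vermaF (vermaE v) =
  (q - q^-1)^-1 *: (vermaK v - vermaKV v).
Proof.
apply: (@linear_ext _ _ _ ((vermaE \o vermaF) \- (vermaF \o vermaE))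
  ((q - q^-1)^-1 \*: (vermaK \- vermaKV))) => k /=.
rewrite vermaFU vermaEU vermaKU vermaKVU.
rewrite [vermaE (_ *: _)]linearZ [vermaF (_ *: _)]linearZ /= vermaEU vermaFU /=.
have -> : qnum h (l - wt k) *: (qnum h (l + wt k.-1) *: << k.-1.+1 >>) =
    (qnum h (l - wt k) * qnum h (l + wt k.-1)) *: << k >> :> {malg C[nat]}.
  case: k => [|k]; last by rewrite scalerA.
  by rewrite subr0 subrr qnum0 mul0r !scale0r.
have -> : qnum h (l - wt k) * qnum h (l + wt k.-1) =
    qnum h (l - wt k) * qnum h (l + wt k + 1).
  case: k => [|k]; first by rewrite subr0 subrr qnum0 !mul0r.
  by congr (_ * qnum h _); rewrite -natr1 /=; ring.
have vec (a b c d e f : C) (w : {malg C[nat]}) : a * b - c = d * (e - f) ->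
    a *: (b *: w) - c *: w = d *: (e *: w - f *: w).
  by move=> abc; rewrite scalerA -[LHS]scalerBl abc -scalerA; congr (_ *: _);
    rewrite scalerBl.
apply: vec.
set x := qpow h k%:R; set y := qpow h l.
have -> : l - wt k.+1 = k%:R + 1 by rewrite -natr1; ring.
have -> : l - wt k = k%:R by ring.
rewrite /qnum.
have -> : qpow h (l + wt k) = y ^+ 2 / x.
  by rewrite !(qpowD, qpowN) -/x -/y; ring.
have -> : qpow h (- (l + wt k)) = x / y ^+ 2.
  by rewrite qpowN !(qpowD, qpowN) -/x -/y mulrA -expr2 invf_div.
have -> : qpow h (k%:R + 1) = x * q by rewrite qpowD qpow1.
have -> : qpow h (- (k%:R + 1)) = (x * q)^-1 by rewrite qpowN qpowD qpow1.
have -> : qpow h (l + wt k + 1) = y ^+ 2 / x * q.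
  by rewrite !(qpowD, qpowN) qpow1 -/x -/y; ring.
have -> : qpow h (- (l + wt k + 1)) = (y ^+ 2 / x * q)^-1.
  by rewrite qpowN !(qpowD, qpowN) qpow1 -/x -/y; congr (_^-1); ring.
have -> : qpow h (2%:R * wt k) = (y / x) ^+ 2.
  by rewrite [2%:R * _]mulr_natl mulr2n !(qpowD, qpowN) -expr2.
rewrite qpowN -/x.
have x0 : x != 0 by apply: qpow_neq0.
have y0 : y != 0 by apply: qpow_neq0.
have q0 : q != 0 by apply: qq_neq0.
have [d0|d0] := eqVneq (q - q^-1) 0; first by rewrite d0 invr0; ring.
have d0' : q ^+ 2 - 1 != 0.
  by apply: contraNneq d0 => qq1; apply/eqP; apply: (mulfI q0); rewrite mulr0
     -qq1; field.
by field; rewrite ?x0 ?y0 ?q0 ?d0'.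
Qed.

Definition verma : uq_module q {malg C[nat]} :=
  @UqModule _ _ _ vermaE vermaF vermaK vermaKV
    vermaKKV vermaKVK vermaKE vermaKF vermaEF.

Definition shapovalov_coef (k : nat) : C :=
  (-1) ^+ k * qpow h (k%:R * (k%:R - 2%:R * l + 1)) * qfact h k
  / \prod_(0 <= j < k) qnum h (2%:R * l - j%:R).

Definition shapovalov : {malg C[nat]} -> {malg C[nat]} -> C :=
  bilext (fun k k' => if k == k' then shapovalov_coef k else 0).

End Verma.

Section ThreeJ.
Variables (l1 l2 : C) (J : nat).
Local Notation l := (l1 + l2 - J%:R).

Definition normalized_embedding
    (psi : {linear {malg C[nat]} -> {malg C[(nat * nat)%type]}}) : Prop :=
  [/\ uq_hom (verma l) (tens_module (qq_neq0 h) (verma l1) (verma l2)) psi,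
      injective psi
    & tens_form (shapovalov l1) (shapovalov l2)
        (psi << 0%N >>) (psi << 0%N >>) = 1].

(* The q3j-symbol [l1 l2 l; a1 a2 a] of psi, with a = l - k and
   ai = li - ki. *)
Definition q3j (psi : {malg C[nat]} -> {malg C[(nat * nat)%type]})
    (k k1 k2 : nat) : C := (psi << k >>)@_(k1, k2).

(* The expression under the square root in Delta(l1, l2, l). *)
Definition Delta_sq : C :=
  qfact h J *
  \prod_(0 <= j < J) (qnum h (2%:R * l1 - j%:R) * qnum h (2%:R * l2 - j%:R)
                      / qnum h (2%:R * l + 2%:R + j%:R)).

Variable D : C.  (* the chosen value of Delta(l1, l2, l) *)

(* In both sums the constraints z <= k1 and w <= k2 drop the terms having the
   factorial of a negative integer in the denominator. *)
Definition racah_fock (k k1 k2 : nat) : C :=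
  let a := l - k%:R in
  let a1 := l1 - k1%:R in
  let a2 := l2 - k2%:R in
  sign_half R J * (-1) ^+ k1
  * qpow h ((l2 ^+ 2 - a2 ^+ 2) - (l ^+ 2 - a ^+ 2) - (l1 - a1))
  * (qfact h k / \prod_(1 <= j < k.+1) qnum h (l + a + j%:R)) * D
  * \sum_(z < k.+1) \sum_(w < k.+1 | [&& z + w == k, z <= k1 & w <= k2]%N)
      (-1) ^+ z * qpow h (z%:R * (l + a + 1))
      * ((\prod_(1 <= j < z.+1) qnum h (l1 + a1 + j%:R))
         * (\prod_(1 <= j < w.+1) qnum h (l2 + a2 + j%:R))
         / (qfact h z * qfact h w * qfact h (k1 - z) * qfact h (k2 - w))).

Definition van_der_waerden (k k1 k2 : nat) : C :=
  let a := l - k%:R in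
  let a1 := l1 - k1%:R in
  let a2 := l2 - k2%:R in
  sign_half R J
  * qpow h (l1 ^+ 2 + l2 ^+ 2 - l ^+ 2 + l1 * l2 + a1 * a2 + l1 * a2 - l2 * a1)
  * (qfact h k / \prod_(1 <= j < k.+1) qnum h (l + a + j%:R)) * D
  * \sum_(z < J.+1) \sum_(w < J.+1 | [&& z + w == J, z <= k1 & w <= k2]%N)
      (-1) ^+ z * qpow h (- (z%:R * (l1 + l2 + l + 1)))
      * (qratio h (l2 - l1 + l) (l2 + a2 - z%:R)
         * qratio h (l1 - l2 + l) (l1 + a1 - w%:R)
         / (qfact h z * qfact h w * qfact h (k1 - z) * qfact h (k2 - w))).

End ThreeJ.
End Modules.

Definition not_half_nat (R : realType) (x : R[i]) : Prop :=
  forall n : nat, x != n%:R / 2%:R.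

(* Main.v *)
(* A homomorphism psi is determined by psi(e_l): it has weight l, and
   E psi(e_l) = 0 is a two-term recurrence on its coordinates, so psi(e_l) is
   proportional to an explicit vector v0, given by the case a = l of either
   formula. The constant of proportionality is D up to a unit, and the
   q-Vandermonde identity turns the norm of psi(e_l) into D^2 / Delta^2, whence
   D^2 = Delta^2. The other coordinates follow from
   [l + a] psi(e_(a-1)) = F psi(e_a), a recurrence which the right-hand sides of
   both formulas satisfy: the Racah-Fock sum termwise, the Van der Waerden sum
   up to terms that cancel in pairs. Conversely
   e_(l-k) |-> F^k v0 / prod_(j < k) [2l - j] commutes with F and K by
   construction, and with E because [E, F] is a function of K. *)
From HB Require Import structures.
Require Import Defs.
From mathcomp Require Import all_boot all_order all_algebra.
From mathcomp Require Import finmap monalg.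
From mathcomp Require Import complex ring zify.
From mathcomp Require Import reals trigo exp.

Set Implicit Arguments.
Unset Strict Implicit.
Unset Printing Implicit Defensive.

Import Order.TTheory GRing.Theory Num.Theory.
Local Open Scope ring_scope.
Local Open Scope complex_scope.

(** * Sums over z + w = N *)

Section AntidiagonalSums.
Variable V : nmodType.
Implicit Types f g : nat -> nat -> V.

Definition asum N f : V := \sum_(i < N.+1) f i (N - i)%N.

Lemma eq_asum N f g :
  (forall z w, (z + w)%N = N -> f z w = g z w) -> asum N f = asum N g.
Proof.
by move=> fg; apply: eq_bigr => i _; apply: fg; rewrite subnKC // -ltnS.
Qed.

Lemma asumD N f g : asum N (fun z w => f z w + g z w) = asum N f + asum N g.
Proof. exact: big_split. Qed.

Lemma asum0 f : asum 0 f = f 0%N 0%N.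
Proof. by rewrite /asum big_ord_recl big_ord0 addr0. Qed.

(** Meant for summands with a factor [z] / [z]!: it vanishes at z = 0, and the shift turns it into 1
    / [z]!. *)
Lemma asum_shiftl N f : f 0%N N.+1 = 0 ->
  asum N.+1 f = asum N (fun z w => f z.+1 w).
Proof. by move=> f0; rewrite /asum big_ord_recl /= f0 add0r. Qed.

Lemma asum_shiftr N f : f N.+1 0%N = 0 ->
  asum N.+1 f = asum N (fun z w => f z w.+1).
Proof.
move=> f0; rewrite /asum big_ord_recr /= subnn f0 addr0.
by apply: eq_bigr => i _ /=; rewrite subSn // -ltnS.
Qed.

Lemma asum_single N f z w : (z + w)%N = N ->
  (forall z' w', (z' + w')%N = N -> z' != z -> f z' w' = 0) ->
  asum N f = f z w.
Proof.
move=> zwN f0; have zN : (z < N.+1)%N by rewrite -zwN ltnS leq_addr.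
rewrite /asum (bigD1 (Ordinal zN)) //= big1 => [|i iz].
  by rewrite addr0 -zwN addKn.
by apply: f0; rewrite ?subnKC // -ltnS.
Qed.

(** [f] extends [F] by zero to the pairs with z + w = N that [Q] excludes, so the bounds z <= k1 and
    w <= k2 become zeros of the summand. *)
Lemma double_sum_asum N (Q : 'I_N.+1 -> 'I_N.+1 -> bool) F f :
  (forall z w, (if Q z w then F z w else 0) =
     (if (z + w)%N == N then f z w else 0)) ->
  \sum_(z < N.+1) \sum_(w < N.+1 | Q z w) F z w = asum N f.
Proof.
move=> Ff; apply: eq_bigr => z _; rewrite big_mkcond; under eq_bigr do rewrite Ff.
have wN : (N - z < N.+1)%N by rewrite ltnS leq_subr.
have zN : (z <= N)%N by rewrite -ltnS.
rewrite (bigD1 (Ordinal wN)) //= subnKC // eqxx big1 ?addr0 // => i iw.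
case: ifP => // /eqP zi.
by case/negP: iw; apply/eqP/val_inj => /=; lia.
Qed.

End AntidiagonalSums.

Lemma asumZ (C : pzSemiRingType) N (a : C) f :
  asum N (fun z w => a * f z w) = a * asum N f.
Proof. by rewrite /asum mulr_sumr. Qed.

(** * Identities for q-numbers *)

Section QCalculus.
Variables (R : realType) (h : R[i]).
Local Notation C := R[i].
Local Notation qnum := (qnum h).
Local Notation qpow := (qpow h).
Local Notation qfact := (qfact h).

(** The engine of the summation identities: [z + w] splits into a part with [z] and a part with [w],
    each of which cancels against a factorial. *)
Lemma qnumD x y : qnum (x + y) = qpow y * qnum x + qpow (- x) * qnum y.
Proof. by rewrite /Defs.qnum opprD !qpowD; ring. Qed.

(** The product begins at [x + 1], as in both formulas, so that [qrise x n] is [x + n | x] and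
    [qfall x n] is [x | x - n]. *)
Definition qrise (x : C) n := \prod_(1 <= j < n.+1) qnum (x + j%:R).
Definition qfall (x : C) n := \prod_(0 <= j < n) qnum (x - j%:R).

Lemma qrise0 x : qrise x 0 = 1.
Proof. by rewrite /qrise big_geq. Qed.

Lemma qriseSr x n : qrise x n.+1 = qrise x n * qnum (x + n.+1%:R).
Proof. by rewrite /qrise big_nat_recr. Qed.

Lemma qriseS x n : qrise x n.+1 = qnum (x + 1) * qrise (x + 1) n.
Proof.
rewrite /qrise big_nat_recl //; congr (_ * _).
apply: eq_bigr => j _; congr qnum.
by rewrite -natr1; ring.
Qed.

Lemma qfall0 x : qfall x 0 = 1.
Proof. by rewrite /qfall big_geq. Qed.

Lemma qfallS x n : qfall x n.+1 = qfall x n * qnum (x - n%:R).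
Proof. by rewrite /qfall big_nat_recr. Qed.

Lemma qfall_rise x n : qfall x n = qrise (x - n%:R) n.
Proof.
elim: n x => [|n IHn] x; first by rewrite qfall0 qrise0.
rewrite qfallS qriseS IHn mulrC; congr (qnum _ * qrise _ _);
  by rewrite -[n.+1%:R]natr1; ring.
Qed.

Lemma qfallD x m n : qfall x (m + n) = qfall x m * qfall (x - m%:R) n.
Proof.
elim: n => [|n IHn]; first by rewrite addn0 qfall0 mulr1.
by rewrite addnS !qfallS IHn -mulrA natrD opprD addrA.
Qed.

Lemma qfact0 : qfact 0 = 1.
Proof. by rewrite /Defs.qfact big_geq. Qed.

Lemma qfactS n : qfact n.+1 = qfact n * qnum n.+1%:R.
Proof. by rewrite /Defs.qfact big_nat_recr. Qed.

Hypothesis qnat_neq0 : forall n : nat, qnum n.+1%:R != 0.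

Lemma qfact_neq0 n : qfact n != 0.
Proof. by elim: n => [|n IHn]; rewrite ?qfact0 ?oner_eq0 // qfactS mulf_neq0. Qed.

Lemma qnum_div_qfactS n : qnum n.+1%:R / qfact n.+1 = (qfact n)^-1.
Proof. by rewrite qfactS; field; rewrite qfact_neq0 qnat_neq0. Qed.

(* 1 / [m - n]!, with value 0 when m < n *)
Definition iqfact m n : C := if (n <= m)%N then (qfact (m - n))^-1 else 0.

(* The q-binomial coefficient of x over m - n, with value 0 when m < n *)
Definition qbin (x : C) m n : C :=
  if (n <= m)%N then qfall x (m - n) / qfact (m - n) else 0.

(** The condition that [vdw_sum_rec] puts on [g1] and [g2]. One factor leaves both the falling
    product and the factorial; at n = m it rests on [0] = 0. *)
Lemma qbin_shift x m n :
  qnum (m%:R - n%:R) * qbin x m n =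
  qnum (x - m%:R + n.+1%:R) * qbin x m n.+1.
Proof.
rewrite /qbin; case: (ltngtP n m) => [nm|nm|->]; rewrite ?mulr0 //; last first.
  by rewrite subrr qnum0 mul0r.
rewrite -(subnSK nm) qfallS qfactS.
have -> : m%:R - n%:R = (m - n.+1).+1%:R :> C by rewrite subnSK // natrB // ltnW.
have -> : x - m%:R + n.+1%:R = x - (m - n.+1)%:R by rewrite natrB //; ring.
by field; rewrite qfact_neq0 qnat_neq0.
Qed.

(* The sum of the Racah-Fock formula, with arbitrary sequences g1 and g2 in
   place of 1 / [k1 - z]! and 1 / [k2 - w]! *)
Definition rf_sum (c x1 x2 : C) (g1 g2 : nat -> C) k :=
  asum k (fun z w => (-1) ^+ z * qpow (z%:R * c)
    * (qrise x1 z * qrise x2 w / (qfact z * qfact w)) * (g1 z * g2 w)).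

(** Splitting [k + 1] = [z + w] and shifting z or w gives two sums, one for each term of the
    coproduct of F. The change from c - 1 to c reflects that a drops by 1 in q^(z (l + a + 1)). *)
Lemma rf_sum_rec c x1 x2 g1 g2 k :
  qnum k.+1%:R * rf_sum (c - 1) x1 x2 g1 g2 k.+1 =
  - qpow (c - 1 - k%:R) * qnum (x1 + 1)
      * rf_sum c (x1 + 1) x2 (fun z => g1 z.+1) g2 k
  + qnum (x2 + 1) * rf_sum c x1 (x2 + 1) g1 (fun w => g2 w.+1) k.
Proof.
pose t z w : C := (-1) ^+ z * qpow (z%:R * (c - 1))
    * (qrise x1 z * qrise x2 w) * (g1 z * g2 w).
have -> : qnum k.+1%:R * rf_sum (c - 1) x1 x2 g1 g2 k.+1 =
   asum k.+1 (fun z w => t z w * qpow (- w%:R) * (qnum z%:R / qfact z) / qfact w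
     + t z w * qpow z%:R * (qnum w%:R / qfact w) / qfact z).
  rewrite -asumZ; apply: eq_asum => z w zw; rewrite -zw natrD addrC qnumD /t.
  by rewrite invfM; ring.
rewrite asumD asum_shiftl ?qnum0 ?(mul0r, mulr0) // asum_shiftr; last first.
  by rewrite qnum0 !(mul0r, mulr0).
rewrite -!asumZ; congr (_ + _); apply: eq_asum => z w zw.
  rewrite qnum_div_qfactS /t qriseS exprS.
  have -> : qpow (z.+1%:R * (c - 1)) = qpow (z%:R * c)
     * qpow (c - 1 - k%:R) * qpow w%:R.
    by rewrite -!qpowD -zw natrD -natr1; congr qpow; ring.
  rewrite qpowN; field.
  by rewrite !qfact_neq0 qpow_neq0.
rewrite qnum_div_qfactS /t qriseS.
have -> : qpow (z%:R * c) = qpow (z%:R * (c - 1)) * qpow z%:R.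
  by rewrite -!qpowD; congr qpow; ring.
by rewrite invfM; ring.
Qed.

(* The sum of the Van der Waerden formula, with arbitrary sequences g1 and g2 in
   place of [2 l1 - J choose k1 - z] and [2 l2 - J choose k2 - w] *)
Definition vdw_sum (x y : C) (g1 g2 : nat -> C) J :=
  asum J (fun z w => (-1) ^+ z * qpow (- (z%:R * (x + y + J%:R + 1)))
    / (qfact z * qfact w) * (g1 z * g2 w)).

(* The terms left over after splitting [x + J - k1 + 1] and [y + J - k2 + 1]
   cancel in pairs (z, w + 1), (z + 1, w). *)
Lemma vdw_sum_rec (x y k1 k2 : C) g1 g2 J :
  (forall z, qnum (k1 - z%:R) * g1 z = qnum (x - k1 + z.+1%:R) * g1 z.+1) ->
  (forall w, qnum (k2 - w%:R) * g2 w = qnum (y - k2 + w.+1%:R) * g2 w.+1) ->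
  qnum (k1 + k2 - J%:R) * vdw_sum x y g1 g2 J =
  qpow (- k2) * qnum (x + J%:R - k1 + 1) * vdw_sum x y (fun z => g1 z.+1) g2 J
  + qpow k1 * qnum (y + J%:R - k2 + 1) * vdw_sum x y g1 (fun w => g2 w.+1) J.
Proof.
move=> g1P g2P.
pose t z : C := (-1) ^+ z * qpow (- (z%:R * (x + y + J%:R + 1))).
pose L z w := t z * qpow (- k2 - (x - k1 + z.+1%:R)) * (qnum w%:R / qfact w)
   / qfact z * (g1 z.+1 * g2 w).
pose M z w := t z * qpow (k1 + (y - k2 + w.+1%:R)) * (qnum z%:R / qfact z)
   / qfact w * (g1 z * g2 w.+1).
have LM0 : asum J (fun z w => L z w + M z w) = 0.
  rewrite asumD; case: J @t @L @M => [|N] t L M.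
    by rewrite !asum0 /L /M qnum0 !(mul0r, mulr0) addr0.
  rewrite asum_shiftr; last by rewrite /L qnum0 !(mul0r, mulr0).
  rewrite [X in _ + X]asum_shiftl; last by rewrite /M qnum0 !(mul0r, mulr0).
  rewrite -asumD -[RHS](mul0r (asum N (fun _ _ => 0))) -asumZ.
  apply: eq_asum => z w zw; rewrite /L /M !qnum_div_qfactS /t exprS.
  rewrite mul0r.
  have -> : qpow (- (z%:R * (x + y + N.+1%:R + 1))) =
     qpow (- (z.+1%:R * (x + y + N.+1%:R + 1))) * qpow (x + y + N.+1%:R + 1).
    by rewrite -qpowD -natr1; congr qpow; ring.
  have -> : qpow (k1 + (y - k2 + w.+1%:R)) =
     qpow (x + y + N.+1%:R + 1) * qpow (- k2 - (x - k1 + z.+1%:R)).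
    by rewrite -qpowD -zw -!natr1 natrD; congr qpow; ring.
  by ring.
rewrite -[LHS]addr0 -LM0 -!asumZ -!asumD; apply/esym/eq_asum => z w zw.
have -> : x + J%:R - k1 + 1 = x - k1 + z.+1%:R + w%:R by rewrite -zw natrD; ring.
have -> : y + J%:R - k2 + 1 = y - k2 + w.+1%:R + z%:R by rewrite -zw natrD; ring.
have -> : k1 + k2 - J%:R = (k1 - z%:R) + (k2 - w%:R) by rewrite -zw natrD; ring.
rewrite [qnum (x - k1 + _ + _)]qnumD [y - k2 + _ + _]addrC.
rewrite [qnum (z%:R + _)]qnumD [k1 - _ + _]addrC [qnum (k2 - _ + _)]qnumD.
rewrite /L /M -!/(t z) !qpowD opprB qpowD.
apply/subr0_eq.
(* With the leftover terms added, the two sides differ termwise by a combination of the defects in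
   [g1P] and [g2P]. *)
pose r := t z / (qfact z * qfact w).
transitivity
 (r * qpow (- k2) * qpow w%:R * g2 w
    * (qnum (x - k1 + z.+1%:R) * g1 z.+1 - qnum (k1 - z%:R) * g1 z)
  + r * qpow k1 * qpow (- z%:R) * g1 z
    * (qnum (y - k2 + w.+1%:R) * g2 w.+1 - qnum (k2 - w%:R) * g2 w)).
  rewrite /r invfM; ring.
by rewrite g1P g2P !subrr !mulr0 addr0.
Qed.

(** Induction on N: [N + 1] = [i + j] is split and the indices shifted; the new factors [x + j + 1]
    and [y + i + 1] then recombine to [x + y + N + 2] by the same addition formula. *)
Lemma q_vandermonde (x y : C) N :
  qfact N * asum N (fun i j => qpow (j%:R * (y + 1) - i%:R * (x + 1))
     * (qrise x j * qrise y i / (qfact i * qfact j))) = qrise (x + y + 1) N.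
Proof.
elim: N => [|N IHN].
  by rewrite asum0 !mul0r subr0 qpow0 !qrise0 qfact0 !mul1r invr1.
rewrite qriseSr -IHN qfactS -[LHS]mulrA -[RHS]mulrA; congr (_ * _).
pose t i j : C :=
  qpow (j%:R * (y + 1) - i%:R * (x + 1)) * (qrise x j * qrise y i).
rewrite [RHS]mulrC -!asumZ.
transitivity (asum N.+1 (fun i j =>
    t i j * qpow i%:R * (qnum j%:R / qfact j) / qfact i
    + t i j * qpow (- j%:R) * (qnum i%:R / qfact i) / qfact j)).
  apply: eq_asum => i j ij; rewrite -ij natrD addrC qnumD /t invfM; ring.
rewrite asumD asum_shiftr ?qnum0 ?(mul0r, mulr0) // asum_shiftl; last first.
  by rewrite qnum0 !(mul0r, mulr0).
rewrite -asumD; apply: eq_asum => i j ij.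
rewrite [qnum j.+1%:R / _]qnum_div_qfactS [qnum i.+1%:R / _]qnum_div_qfactS.
rewrite /t !qriseSr.
have -> : x + y + 1 + N.+1%:R = (x + j.+1%:R) + (y + i.+1%:R).
  by rewrite -ij -!natr1 natrD; ring.
rewrite [qnum (_ + _ + _)]qnumD invfM.
have -> : qpow (j.+1%:R * (y + 1) - i%:R * (x + 1)) =
   qpow (j%:R * (y + 1) - i%:R * (x + 1)) * qpow (y + i.+1%:R) * qpow (- i%:R).
  by rewrite -!qpowD -!natr1; congr qpow; ring.
have -> : qpow (j%:R * (y + 1) - i.+1%:R * (x + 1)) =
   qpow (j%:R * (y + 1) - i%:R * (x + 1)) * qpow (- (x + j.+1%:R)) * qpow j%:R.
  by rewrite -!qpowD -!natr1; congr qpow; ring.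
rewrite [qpow (- i%:R)]qpowN [qpow (- j%:R)]qpowN.
by field; rewrite !qfact_neq0 !qpow_neq0.
Qed.

End QCalculus.

(** * The two formulas and the action of F *)

Section Coefficients.
Variables (R : realType) (h l1 l2 : R[i]) (J : nat).
Local Notation C := R[i].
Local Notation qnum := (qnum h).
Local Notation qpow := (qpow h).
Local Notation qfact := (qfact h).
Local Notation l := (l1 + l2 - J%:R).
Local Notation wt m k := (m - k%:R).
Local Notation x := (l1 + l1 - J%:R).
Local Notation y := (l2 + l2 - J%:R).

(* The coordinates of F (\sum u k1 k2 e_(l1 - k1) (x) e_(l2 - k2)) *)
Definition F_coef (u : nat -> nat -> C) k1 k2 : C :=
  (if k1 is k.+1 then qnum (l1 + wt l1 k) * u k k2 else 0)
  + (qpow (2%:R * wt l1 k1))^-1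
    * (if k2 is k.+1 then qnum (l2 + wt l2 k) * u k1 k else 0).

Hypothesis qnat_neq0 : forall n : nat, qnum n.+1%:R != 0.
Hypothesis qwt_neq0 : forall k : nat, qnum (l + wt l k) != 0.

(** Since [l + a] is invertible, the action of F is a recurrence in k determined by its values at k
    = 0. It serves to compare a homomorphism with a formula and the two formulas with each other. *)
Lemma F_coef_unique (c c' : nat -> nat -> nat -> C) :
  (forall k1 k2, (k1 + k2)%N = J -> c 0%N k1 k2 = c' 0%N k1 k2) ->
  (forall k k1 k2, (k1 + k2)%N = (k.+1 + J)%N ->
    qnum (l + wt l k) * c k.+1 k1 k2 = F_coef (c k) k1 k2) ->
  (forall k k1 k2, (k1 + k2)%N = (k.+1 + J)%N ->
    qnum (l + wt l k) * c' k.+1 k1 k2 = F_coef (c' k) k1 k2) ->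
  forall k k1 k2, (k1 + k2)%N = (k + J)%N -> c k k1 k2 = c' k k1 k2.
Proof.
move=> c0 cF c'F; elim=> [|k IHk] k1 k2 kJ; first exact: c0.
apply: (mulfI (qwt_neq0 k)); rewrite cF // c'F // /F_coef.
congr (_ + _ * _); first by case: k1 kJ => // k1 kJ; rewrite IHk //; lia.
by case: k2 kJ => // k2 kJ; rewrite IHk //; lia.
Qed.

Definition ratio_prefactor k : C := qfact k / qrise h (l + wt l k) k.

Lemma ratio_prefactor0 : ratio_prefactor 0 = 1.
Proof. by rewrite /ratio_prefactor qfact0 qrise0 divr1. Qed.

Lemma ratio_prefactorS k :
  qnum (l + wt l k) * ratio_prefactor k.+1 = qnum k.+1%:R * ratio_prefactor k.
Proof.
have E : l + wt l k.+1 + 1 = l + wt l k by rewrite -natr1; ring.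
rewrite /ratio_prefactor qriseS E qfactS.
(* If this product is 0, both sides are 0 because 0^-1 = 0. *)
have [->|r0] := eqVneq (qrise h (l + wt l k) k) 0.
  by rewrite mulr0 invr0 !mulr0.
by field; rewrite r0 qwt_neq0.
Qed.

Variable D : C.

Lemma racah_fockE k k1 k2 :
  racah_fock h l1 l2 J D k k1 k2 =
  sign_half R J * (-1) ^+ k1
  * qpow ((l2 ^+ 2 - wt l2 k2 ^+ 2) - (l ^+ 2 - wt l k ^+ 2) - (l1 - wt l1 k1))
  * ratio_prefactor k * D
  * rf_sum h (l + wt l k + 1) (l1 + wt l1 k1) (l2 + wt l2 k2)
      (iqfact h k1) (iqfact h k2) k.
Proof.
rewrite /racah_fock; congr (_ * _).
apply: double_sum_asum => z w; case: eqP => //= _.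
rewrite /iqfact; case: leqP => _; rewrite ?(mul0r, mulr0) //=.
by case: leqP => _; rewrite ?mulr0 // /qrise !invfM; ring.
Qed.

Lemma racah_fock_rec k k1 k2 : (k1 + k2)%N = (k.+1 + J)%N ->
  qnum (l + wt l k) * racah_fock h l1 l2 J D k.+1 k1 k2 =
  F_coef (racah_fock h l1 l2 J D k) k1 k2.
Proof.
move=> kJ; pose c := l + wt l k + 1.
pose rf := rf_sum h c.
rewrite racah_fockE.
have -> : l + wt l k.+1 + 1 = c - 1 by rewrite /c -natr1; ring.
pose u e : C := sign_half R J * (-1) ^+ k1 * qpow e * ratio_prefactor k * D.
pose e k0 :=
  (l2 ^+ 2 - wt l2 k2 ^+ 2) - (l ^+ 2 - wt l k0 ^+ 2) - (l1 - wt l1 k1).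
transitivity (u (e k.+1) * (qnum k.+1%:R * rf_sum h (c - 1) (l1 + wt l1 k1)
    (l2 + wt l2 k2) (iqfact h k1) (iqfact h k2) k.+1)).
  transitivity (sign_half R J * (-1) ^+ k1 * qpow (e k.+1) * D *
    rf_sum h (c - 1) (l1 + wt l1 k1) (l2 + wt l2 k2) (iqfact h k1) (iqfact h k2)
      k.+1 * (qnum (l + wt l k) * ratio_prefactor k.+1)).
    by rewrite /e; ring.
  by rewrite ratio_prefactorS /u; ring.
rewrite rf_sum_rec // mulrDr /F_coef; congr (_ + _).
  (* For k1 = 0 this term of F is absent, and the sum vanishes because [iqfact h 0 z.+1] is 0. *)
  case: k1 {kJ} @u @e => [|k1] u e.
    by rewrite /rf_sum /asum big1 ?mulr0 // => i _; rewrite mul0r mulr0.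
  rewrite racah_fockE -/c.
  have -> : l1 + wt l1 k1.+1 + 1 = l1 + wt l1 k1 by rewrite -natr1; ring.
  have -> :
    qpow (l2 ^+ 2 - wt l2 k2 ^+ 2 - (l ^+ 2 - wt l k ^+ 2) - (l1 - wt l1 k1))
     = qpow (e k.+1) * qpow (c - 1 - k%:R).
    by rewrite -qpowD /e /c -!natr1; congr qpow; ring.
  by rewrite /u exprS; ring.
case: k2 kJ @e => [|k2] kJ e.
  by rewrite /rf_sum /asum big1 ?mulr0 // => i _; rewrite !mulr0.
rewrite racah_fockE -/c.
have -> : l2 + wt l2 k2.+1 + 1 = l2 + wt l2 k2 by rewrite -natr1; ring.
have -> :
    qpow (l2 ^+ 2 - wt l2 k2 ^+ 2 - (l ^+ 2 - wt l k ^+ 2) - (l1 - wt l1 k1))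
   = qpow (e k.+1) * qpow (2%:R * wt l1 k1).
  (* The exponents agree only on the weight space, so k2 is eliminated through k1 + k2 = k + J. *)
  have kJR : k2%:R = k%:R + J%:R - k1%:R :> C.
    by rewrite -natrD (_ : (k + J)%N = (k1 + k2)%N) ?natrD; [ring|lia].
  by rewrite -qpowD /e -!natr1 kJR; congr qpow; ring.
by rewrite /u; field; rewrite qpow_neq0.
Qed.

Lemma qratio_qfall (a z : C) m : a - z = m%:R -> qratio h a z = qfall h a m.
Proof.
move=> azm; have -> : z = a - m%:R by rewrite -azm; ring.
rewrite /qratio qfall_rise.
have -> : a - (a - m%:R) = m%:R by ring.
have -> : complex.Re (m%:R : C) = m%:R by rewrite raddfMn.
by rewrite -[m%:R]/(Posz m)%:~R intrKfloor.
Qed.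

(** As z + w = J, the first bracket has k2 - w factors and the second k1 - z; divided by [k2 - w]!
    and [k1 - z]! they become q-binomials. *)
Lemma van_der_waerdenE k k1 k2 : (k1 + k2)%N = (k + J)%N ->
  van_der_waerden h l1 l2 J D k k1 k2 =
  sign_half R J
  * qpow (l1 ^+ 2 + l2 ^+ 2 - l ^+ 2 + l1 * l2 + wt l1 k1 * wt l2 k2
          + l1 * wt l2 k2 - l2 * wt l1 k1)
  * ratio_prefactor k * D
  * vdw_sum h x y (qbin h x k1) (qbin h y k2) J.
Proof.
move=> kJ; rewrite /van_der_waerden; congr (_ * _).
apply: double_sum_asum => z w; case: eqP => //=.
move: (z : nat) (w : nat) => {}z {}w zw; rewrite /qbin.
case: leqP => zk; rewrite ?(mul0r, mulr0) //=.
case: leqP => wk; rewrite ?mulr0 //.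
rewrite (@qratio_qfall _ _ (k2 - w)) => [|]; last first.
  by rewrite natrB // -zw natrD; ring.
rewrite (@qratio_qfall _ _ (k1 - z)) => [|]; last first.
  by rewrite natrB // -zw natrD; ring.
have -> : l2 - l1 + l = y by ring.
have -> : l1 - l2 + l = x by ring.
have -> : l1 + l2 + l + 1 = x + y + J%:R + 1 by ring.
by rewrite !invfM; ring.
Qed.

Lemma van_der_waerden_rec k k1 k2 : (k1 + k2)%N = (k.+1 + J)%N ->
  qnum (l + wt l k) * van_der_waerden h l1 l2 J D k.+1 k1 k2 =
  F_coef (van_der_waerden h l1 l2 J D k) k1 k2.
Proof.
move=> kJ; rewrite van_der_waerdenE //.
pose e k1 k2 := l1 ^+ 2 + l2 ^+ 2 - l ^+ 2 + l1 * l2 + wt l1 k1 * wt l2 k2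
  + l1 * wt l2 k2 - l2 * wt l1 k1.
pose u e : C := sign_half R J * qpow e * ratio_prefactor k * D.
pose S := vdw_sum h x y (qbin h x k1) (qbin h y k2) J.
transitivity (u (e k1 k2) * (qnum (k1%:R + k2%:R - J%:R) * S)).
  (* This is the factor [k + 1] produced by [ratio_prefactorS]. *)
  have -> : k1%:R + k2%:R - J%:R = k.+1%:R :> C.
    by rewrite -natrD kJ natrD; ring.
  transitivity (sign_half R J * qpow (e k1 k2) * D * S *
     (qnum (l + wt l k) * ratio_prefactor k.+1)); first by rewrite /S /e; ring.
  by rewrite ratio_prefactorS /u; ring.
rewrite vdw_sum_rec => [|||w] //; try exact: qbin_shift.
rewrite mulrDr /F_coef; congr (_ + _).
  case: k1 @S kJ => [|k1] S kJ.
    rewrite /vdw_sum /asum big1 ?mulr0 // => i _.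
    by rewrite [qbin h x 0 _]/qbin mul0r mulr0.
  rewrite van_der_waerdenE; last by lia.
  have -> : x + J%:R - k1.+1%:R + 1 = l1 + wt l1 k1 by rewrite -natr1; ring.
  rewrite -!/(e _ _).
  have -> : qpow (e k1 k2) = qpow (e k1.+1 k2) * qpow (- k2%:R).
    by rewrite -qpowD /e -!natr1; congr qpow; ring.
  (* A q-binomial depends only on the difference of its two indices, so the shifted sequence is
     convertible to the one for k1. *)
  rewrite -[vdw_sum h x y (qbin h x k1) _ _]/
    (vdw_sum h x y (fun z => qbin h x k1.+1 z.+1) _ _).
  by rewrite /u; ring.
case: k2 @S kJ => [|k2] S kJ.
  rewrite /vdw_sum /asum big1 ?mulr0 // => i _.
  by rewrite [qbin h y 0 _]/qbin !mulr0.
rewrite van_der_waerdenE; last by lia.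
have -> : y + J%:R - k2.+1%:R + 1 = l2 + wt l2 k2 by rewrite -natr1; ring.
rewrite -!/(e _ _) /u.
have -> : qpow (e k1 k2.+1) = qpow (e k1 k2) * (qpow (2%:R * wt l1 k1))^-1
   * (qpow k1%:R)^-1.
  by rewrite -!qpowN -!qpowD /e -!natr1; congr qpow; ring.
by field; rewrite !qpow_neq0.
Qed.

Lemma racah_fock0 k1 k2 :
  racah_fock h l1 l2 J D 0 k1 k2 = sign_half R J * (-1) ^+ k1
  * qpow (l2 ^+ 2 - wt l2 k2 ^+ 2 - k1%:R) * D / (qfact k1 * qfact k2).
Proof.
rewrite racah_fockE ratio_prefactor0 /rf_sum asum0 /iqfact !leq0n !subn0 !qrise0.
rewrite !qfact0 mul0r qpow0.
have -> : l2 ^+ 2 - wt l2 k2 ^+ 2 - (l ^+ 2 - wt l 0%N ^+ 2) - (l1 - wt l1 k1) =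
  l2 ^+ 2 - wt l2 k2 ^+ 2 - k1%:R by ring.
by field; rewrite !qfact_neq0.
Qed.

Lemma van_der_waerden0 k1 k2 : (k1 + k2)%N = J ->
  van_der_waerden h l1 l2 J D 0 k1 k2 = racah_fock h l1 l2 J D 0 k1 k2.
Proof.
move=> kJ; rewrite racah_fock0 van_der_waerdenE // ratio_prefactor0 /vdw_sum.
(* As z + w = k1 + k2, the bounds z <= k1 and w <= k2 leave only z = k1, w = k2. *)
rewrite (@asum_single _ _ _ k1 k2) // => [|z w zw zk1]; last first.
  rewrite /qbin; case: (leqP z k1) => zk; rewrite ?mul0r ?mulr0 //.
  by rewrite [(w <= k2)%N]leqNgt ifN ?mulr0 //; lia.
rewrite /qbin !leqnn !subnn !qfall0 qfact0 divr1.
have -> : l2 ^+ 2 - wt l2 k2 ^+ 2 - k1%:R =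
  (l1 ^+ 2 + l2 ^+ 2 - l ^+ 2 + l1 * l2 + wt l1 k1 * wt l2 k2
          + l1 * wt l2 k2 - l2 * wt l1 k1) + - (k1%:R * (x + y + J%:R + 1)).
  by rewrite -kJ natrD; ring.
by rewrite [qpow (_ + - (k1%:R * _))]qpowD; ring.
Qed.

Lemma van_der_waerden_racah_fock k k1 k2 : (k1 + k2)%N = (k + J)%N ->
  van_der_waerden h l1 l2 J D k k1 k2 = racah_fock h l1 l2 J D k k1 k2.
Proof.
apply: F_coef_unique; first exact: van_der_waerden0.
  exact: van_der_waerden_rec.
exact: racah_fock_rec.
Qed.

End Coefficients.

(** * Norm of the highest weight vector *)

Lemma sign_half_sqr (R : realType) J : sign_half R J ^+ 2 = (-1) ^+ J.
Proof.
elim: J => [|J IHJ].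
  rewrite /sign_half mulr0 mul0r -[0 +i* 0]/(0 : R[i]) cexp0.
  by rewrite expr1n expr0.
(* Raising J by 1 multiplies by e^(i pi / 2) = i. *)
have -> : sign_half R J.+1 = sign_half R J * 'i.
  rewrite /sign_half; set a : R[i] := 0 +i* _.
  have -> : a = (0 +i* (pi * J%:R / 2%:R)) + (0 +i* (pi / 2%:R)).
    apply/eqP; rewrite eq_complex /= addr0 eqxx /=; apply/eqP.
    by rewrite -natr1; field.
  rewrite cexpD; congr (_ * _).
  rewrite /cexp /= exp.expR0 cos_pihalf sin_pihalf.
  by apply/eqP; rewrite eq_complex /=; apply/andP; split; apply/eqP; ring.
by rewrite exprMn IHJ sqr_i exprSr.
Qed.

Lemma sign_half_neq0 (R : realType) J : sign_half R J != 0.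
Proof. by rewrite -sqrf_eq0 sign_half_sqr signr_eq0. Qed.

Section Norm.
Variables (R : realType) (h l1 l2 D : R[i]) (J : nat).
Local Notation C := R[i].
Local Notation qnum := (qnum h).
Local Notation l := (l1 + l2 - J%:R).
Hypothesis qnat_neq0 : forall n : nat, qnum n.+1%:R != 0.
Hypothesis q1_neq0 : forall n : nat, qnum (2%:R * l1 - n%:R) != 0.
Hypothesis q2_neq0 : forall n : nat, qnum (2%:R * l2 - n%:R) != 0.

Lemma Delta_sqE : Delta_sq h l1 l2 J =
  qfact h J * qfall h (2%:R * l1) J * qfall h (2%:R * l2) J
  / qrise h (2%:R * l + 1) J.
Proof.
rewrite /Delta_sq big_split big_split prodfV /=.
have -> : qrise h (2%:R * l + 1) J =
    \prod_(0 <= j < J) qnum (2%:R * l + 2%:R + j%:R).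
  rewrite /qrise big_add1 /=; apply: eq_bigr => j _; congr (Defs.qnum h _).
  by rewrite -natr1; ring.
by rewrite /qfall; ring.
Qed.

Lemma qfall_neq0 z n : (forall j : nat, qnum (z - j%:R) != 0) -> qfall h z n != 0.
Proof.
move=> z0; elim: n => [|n IHn]; first by rewrite qfall0 oner_eq0.
by rewrite qfallS mulf_neq0.
Qed.

(** After a common denominator is extracted, the norm is the q-Vandermonde sum for x = 2 l1 - J and
    y = 2 l2 - J, with x + y + 1 = 2 l + 1. *)
Lemma racah_fock_norm :
  asum J (fun k1 k2 => racah_fock h l1 l2 J D 0 k1 k2 ^+ 2
    * (shapovalov_coef h l1 k1 * shapovalov_coef h l2 k2))
  = D ^+ 2 / Delta_sq h l1 l2 J.
Proof.
pose x := 2%:R * l1 - J%:R; pose y := 2%:R * l2 - J%:R.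
have f1 n := qfall_neq0 n q1_neq0; have f2 n := qfall_neq0 n q2_neq0.
transitivity (asum J (fun i j =>
   D ^+ 2 / (qfall h (2%:R * l1) J * qfall h (2%:R * l2) J)
   * (qpow h (j%:R * (y + 1) - i%:R * (x + 1))
      * (qrise h x j * qrise h y i / (qfact h i * qfact h j))))).
  apply: eq_asum => k1 k2 kJ; rewrite racah_fock0 //.
  pose e : C := l2 ^+ 2 - (l2 - k2%:R) ^+ 2 - k1%:R.
  rewrite -/e /shapovalov_coef -!/(qfall h _ _).
  (* The first k1 factors are the Shapovalov denominator; the other k2 form the rising product of
     q-Vandermonde. *)
  have r1 : qfall h (2%:R * l1) J = qfall h (2%:R * l1) k1 * qrise h x k2.
    rewrite -{1}kJ qfallD [qfall h (_ - _) _]qfall_rise.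
    congr (_ * qrise h _ _).
    by rewrite /x -kJ; ring.
  have r2 : qfall h (2%:R * l2) J = qfall h (2%:R * l2) k2 * qrise h y k1.
    rewrite -{1}kJ addnC qfallD [qfall h (_ - _) _]qfall_rise.
    congr (_ * qrise h _ _).
    by rewrite /y -kJ; ring.
  have x0 : qrise h x k2 != 0.
    by apply: contraNneq (f1 J) => x0; rewrite r1 x0 mulr0 eqxx.
  have y0 : qrise h y k1 != 0.
    by apply: contraNneq (f2 J) => y0; rewrite r2 y0 mulr0 eqxx.
  have -> : qpow h (k2%:R * (y + 1) - k1%:R * (x + 1)) =
     qpow h e ^+ 2 * qpow h (k1%:R * (k1%:R - 2%:R * l1 + 1))
       * qpow h (k2%:R * (k2%:R - 2%:R * l2 + 1)).
    by rewrite expr2 -!qpowD /e /x /y -kJ; congr (qpow h _); ring.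
  (* The square of (-1)^(J/2) cancels the signs of the two Shapovalov coefficients. *)
  have sg : (sign_half R J * (-1) ^+ k1) ^+ 2 * ((-1) ^+ k1 * (-1) ^+ k2) = 1.
    by rewrite exprMn sign_half_sqr sqrr_sign mulr1 -exprD kJ -exprD addnn -mul2n
      exprM sqrrN expr1n expr1n.
  rewrite r1 r2 -[RHS]mul1r; rewrite -[X in _ = X * _]sg.
  by field; rewrite !f1 !f2 x0 y0 !qfact_neq0.
rewrite asumZ Delta_sqE.
have -> : 2%:R * l + 1 = x + y + 1 by rewrite /x /y; ring.
rewrite -q_vandermonde //; set S := asum _ _.
(* The denominator of Delta^2 is now [J]! S; for S = 0 both sides are 0 since 0^-1 = 0. *)
have [->|S0] := eqVneq S 0; first by rewrite !(mulr0, invr0).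
by field; rewrite f1 f2 S0 qfact_neq0.
Qed.

End Norm.

(** * Coordinates in the tensor product *)

Section Coordinates.
Variable C : fieldType.

(** The target [C^o] makes a coordinate a linear map, so that identities between coordinates can be
    checked on basis vectors by [linear_ext]. *)
Definition malg_coord (I : choiceType) (i : I) (v : {malg C[I]}) : C^o := v@_i.

Lemma malg_coord_is_linear I i : linear (@malg_coord I i).
Proof. by move=> a u v; rewrite /malg_coord mcoeffD mcoeffZ. Qed.

HB.instance Definition _ I i :=
  GRing.isLinear.Build C {malg C[I]} C^o *:%R (@malg_coord I i)
    (@malg_coord_is_linear I i).

Lemma coordU (I : choiceType) (p r : I) : malg_coord r << p >> = (p == r)%:R.
Proof. exact: mcoeffU. Qed.

Lemma coordD2 (I : choiceType) (a b : C) (p q r : I) :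
  malg_coord r (a *: << p >> + b *: << q >>) = a * (p == r)%:R + b * (q == r)%:R.
Proof. by rewrite linearD !linearZ /= !coordU. Qed.

Lemma mcoeff_asum n (f : nat -> nat -> C) k1 k2 :
  (asum n (fun i j => f i j *: << (i, j) >>))@_(k1, k2) =
  if (k1 + k2 == n)%N then f k1 k2 else 0.
Proof.
transitivity (asum n (fun i j => malg_coord (k1, k2) (f i j *: << (i, j) >>))).
  exact: (linear_sum (@malg_coord _ (k1, k2))).
case: eqP => kn.
  rewrite (@asum_single _ _ _ k1 k2) // /malg_coord => [|i j _ ik1].
    by rewrite mcoeffZ mcoeffUU mulr1.
  rewrite mcoeffZ mcoeffU; case: eqP => [[ik _]|_]; last by rewrite mulr0.
  by rewrite ik eqxx in ik1.
rewrite /asum big1 // => i _; rewrite /malg_coord mcoeffZ mcoeffU.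
case: eqP => [[ik1 ik2]|_]; last by rewrite mulr0.
by case: kn; rewrite -ik1 -ik2 subnKC // -ltnS.
Qed.

Lemma asum_basis n (v : {malg C[(nat * nat)%type]}) :
  (forall k1 k2, (k1 + k2)%N != n -> v@_(k1, k2) = 0) ->
  v = asum n (fun k1 k2 => v@_(k1, k2) *: << (k1, k2) >>).
Proof.
move=> vn; apply/malgP => -[k1 k2].
by rewrite (mcoeff_asum n (fun i j => v@_(i, j))); case: ifPn => // /vn.
Qed.

Lemma bilext_sum (I J : choiceType) (b : I -> J -> C) m n
    (a : 'I_m -> C) (f : 'I_m -> I) (c : 'I_n -> C) (g : 'I_n -> J) :
  bilext b (\sum_i a i *: << f i >>) (\sum_j c j *: << g j >>) =
  \sum_i \sum_j a i * c j * b (f i) (g j).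
Proof.
rewrite bilextE linear_sum; apply: eq_bigr => i _.
rewrite linearZ /= linextU [linext _ _]linear_sum [LHS]mulr_sumr.
apply: eq_bigr => j _.
by rewrite linearZ /= linextU /GRing.scale /= mulrA.
Qed.

End Coordinates.

(** * The Shapovalov form and the generators on a tensor product of Verma modules *)

Section TensorVerma.
Variables (R : realType) (h l1 l2 : R[i]).
Local Notation C := R[i].
Local Notation qnum := (qnum h).
Local Notation qpow := (qpow h).
Local Notation wt m k := (m - k%:R).
Local Notation M1 := (verma h l1).
Local Notation M2 := (verma h l2).

(** The weight basis is orthogonal, so only the squares of the coordinates contribute. *)
Lemma tens_form_shapovalov n (v : {malg C[(nat * nat)%type]}) :
  (forall k1 k2, (k1 + k2)%N != n -> v@_(k1, k2) = 0) ->
  tens_form (shapovalov h l1) (shapovalov h l2) v v =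
  asum n (fun k1 k2 => v@_(k1, k2) ^+ 2
    * (shapovalov_coef h l1 k1 * shapovalov_coef h l2 k2)).
Proof.
move=> vn; rewrite {1 2}(asum_basis vn) /tens_form bilext_sum.
apply: eq_bigr => i _; rewrite (bigD1 i) //= big1 => [|j ji].
  by rewrite addr0 /shapovalov !bilextUU !eqxx expr2.
have ij : (i == j :> nat) = false by apply: contraNF ji => /eqP/val_inj->.
by rewrite /shapovalov !bilextUU ij mul0r mulr0.
Qed.

Lemma tensK_coef v k1 k2 : (tensK M1 M2 v)@_(k1, k2) =
  qpow (2%:R * wt l1 k1) * qpow (2%:R * wt l2 k2) * v@_(k1, k2).
Proof.
apply: (@linear_ext _ _ _ (malg_coord (k1, k2) \o tensK M1 M2)
  ((qpow (2%:R * wt l1 k1) * qpow (2%:R * wt l2 k2)) \*: malg_coord (k1, k2))).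
move=> [i j] /=; rewrite -tensUU tensKE /= vermaKU vermaKU tensZl tensZr tensUU.
rewrite /malg_coord !mcoeffZ mcoeffU /GRing.scale /= mulrA.
by case: eqP => [[-> ->]|] //=; rewrite !mulr0.
Qed.

Lemma tensEU i j : tensE M1 M2 << (i, j) >> =
  (qpow (2%:R * wt l2 j) * qnum i%:R) *: << (i.-1, j) >>
  + qnum j%:R *: << (i, j.-1) >>.
Proof.
rewrite -tensUU tensEE /= vermaEU vermaEU vermaKU.
have wtK (m : C) n : m - wt m n = n%:R by ring.
rewrite (wtK l1) (wtK l2).
by rewrite tensZr tensZl tensUU tensZr tensUU scalerA.
Qed.

Lemma tensFU i j : tensF M1 M2 << (i, j) >> =
  qnum (l1 + wt l1 i) *: << (i.+1, j) >>
  + ((qpow (2%:R * wt l1 i))^-1 * qnum (l2 + wt l2 j)) *: << (i, j.+1) >>.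
Proof.
rewrite -tensUU tensFE /= vermaFU vermaFU vermaKVU.
by congr (_ + _); rewrite tensZl ?[tens _ (qnum _ *: _)]tensZr tensUU ?scalerA.
Qed.

Lemma tensE_coef v k1 k2 : (tensE M1 M2 v)@_(k1, k2) =
  qnum k1.+1%:R * qpow (2%:R * wt l2 k2) * v@_(k1.+1, k2)
  + qnum k2.+1%:R * v@_(k1, k2.+1).
Proof.
apply: (@linear_ext _ _ _ (malg_coord (k1, k2) \o tensE M1 M2)
  (((qnum k1.+1%:R * qpow (2%:R * wt l2 k2)) \*: malg_coord (k1.+1, k2))
   \+ (qnum k2.+1%:R \*: malg_coord (k1, k2.+1)))).
move=> [i j] /=; rewrite tensEU coordD2 !coordU /GRing.scale /= !xpair_eqE.
congr (_ + _).
  (* At i = 0 the truncated predecessor names a spurious basis vector, removed by [0] = 0. *)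
  case: i => [|i]; first by rewrite qnum0 mulr0 mul0r mulr0.
  by rewrite eqSS; case: eqP => [<-|]; case: eqP => [<-|];
    rewrite ?mulr0 // !mulr1 mulrC.
case: j => [|j]; first by rewrite qnum0 andbF mul0r mulr0.
by rewrite eqSS; case: (j =P k2) => [->|]; rewrite ?andbF ?mulr0.
Qed.

Lemma tensF_coef v k1 k2 : (tensF M1 M2 v)@_(k1, k2) =
  F_coef h l1 l2 (fun i j => v@_(i, j)) k1 k2.
Proof.
(* Moving the case distinction of [F_coef] into linear forms makes [linear_ext] applicable. *)
pose g1 : {linear {malg C[(nat * nat)%type]} -> C^o} :=
  if k1 is k.+1 then qnum (l1 + wt l1 k) \*: @malg_coord _ _ (k, k2) else \0.
pose g2 : {linear {malg C[(nat * nat)%type]} -> C^o} :=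
  if k2 is k.+1 then qnum (l2 + wt l2 k) \*: @malg_coord _ _ (k1, k) else \0.
transitivity ((g1 \+ ((qpow (2%:R * wt l1 k1))^-1 \*: g2)) v); last first.
  by rewrite /F_coef /g1 /g2 /=; case: k1 {g1 g2} => [|k1]; case: k2.
apply: (@linear_ext _ _ _ (malg_coord (k1, k2) \o tensF M1 M2)
  (g1 \+ ((qpow (2%:R * wt l1 k1))^-1 \*: g2))).
move=> [i j] /=; rewrite tensFU coordD2 /GRing.scale /= !xpair_eqE.
congr (_ + _).
  case: k1 @g1 @g2 => [|k1] g1 g2; rewrite /g1 /= ?mulr0 //.
  rewrite coordU /GRing.scale /= xpair_eqE eqSS.
  by case: eqP => [<-|] //=; rewrite ?mulr0.
case: k2 {g1} @g2 => [|k2] g2; rewrite /g2 /= ?andbF ?mulr0 //.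
rewrite coordU /GRing.scale /= xpair_eqE eqSS.
by case: (i =P k1) => [->|]; case: (j =P k2) => [->|]; rewrite ?mulr0 ?mulr1.
Qed.

End TensorVerma.

(** * Embeddings of Verma modules *)

Section Embeddings.
Variables (R : realType) (h l1 l2 : R[i]) (J : nat).
Local Notation C := R[i].
Local Notation qnum := (qnum h).
Local Notation qpow := (qpow h).
Local Notation l := (l1 + l2 - J%:R).
Local Notation wt m k := (m - k%:R).
Local Notation M1 := (verma h l1).
Local Notation M2 := (verma h l2).
Local Notation RF := (racah_fock h l1 l2 J).
Local Notation hom psi :=
  (uq_hom (verma h l) (tens_module (qq_neq0 h) M1 M2) psi).

Hypotheses (hl1 : not_half_nat l1) (hl2 : not_half_nat l2).
Hypotheses (hl12 : not_half_nat (l1 + l2)) (hq : generic h l1 l2).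

(** * Nonvanishing of q-numbers from genericity *)

Lemma double_neq_nat (x : C) n : not_half_nat x -> 2%:R * x - n%:R != 0.
Proof.
move=> hx; rewrite subr_eq0; apply: contraNneq (hx n) => <-.
by apply/eqP; field.
Qed.

Lemma qnum_generic_neq0 (n m1 m2 : int) (x : C) :
  x = n%:~R + 2%:R * m1%:~R * l1 + 2%:R * m2%:~R * l2 -> x != 0 ->
  qnum x != 0.
Proof. by move->; apply: hq. Qed.

Lemma qint_neq0 (n : int) : n != 0 -> qnum n%:~R != 0.
Proof.
move=> n0; apply: (@qnum_generic_neq0 n 0 0); last by rewrite intr_eq0.
by rewrite !mulr0 !mul0r !addr0.
Qed.

Lemma qnat_neq0 n : qnum n.+1%:R != 0.
Proof. exact: (@qint_neq0 n.+1). Qed.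

Lemma q2l1_neq0 n : qnum (2%:R * l1 - n%:R) != 0.
Proof.
apply: (@qnum_generic_neq0 (- n%:Z) 1 0); last exact: double_neq_nat.
by rewrite rmorphN /= mulr0 mul0r -pmulrn; ring.
Qed.

Lemma q2l2_neq0 n : qnum (2%:R * l2 - n%:R) != 0.
Proof.
apply: (@qnum_generic_neq0 (- n%:Z) 0 1); last exact: double_neq_nat.
by rewrite rmorphN /= mulr0 mul0r -pmulrn; ring.
Qed.

Lemma q2l12_neq0 n : qnum (2%:R * (l1 + l2) - n%:R) != 0.
Proof.
apply: (@qnum_generic_neq0 (- n%:Z) 1 1); last exact: double_neq_nat.
by rewrite rmorphN /= -pmulrn; ring.
Qed.

Lemma qwt_neq0 k : qnum (l + wt l k) != 0.
Proof.
have -> : l + wt l k = 2%:R * (l1 + l2) - (J + J + k)%:R by ring.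
exact: q2l12_neq0.
Qed.

Lemma Delta_sq_neq0 : Delta_sq h l1 l2 J != 0.
Proof.
rewrite Delta_sqE !mulf_neq0 ?invr_eq0 //.
- exact: qfact_neq0 qnat_neq0 _.
- exact: qfall_neq0 q2l1_neq0.
- exact: qfall_neq0 q2l2_neq0.
rewrite /qrise prodf_seq_neq0; apply/allP => j; rewrite mem_index_iota /=.
(* From 1 <= j <= J follows j + 1 <= 2J, so the argument is 2 (l1 + l2) minus a natural number. *)
case/andP=> j1 jJ; have jJJ : (j.+1 <= J + J)%N by lia.
have -> : 2%:R * l + 1 + j%:R = 2%:R * (l1 + l2) - (J + J - j.+1)%:R.
  by rewrite natrB //; ring.
exact: q2l12_neq0.
Qed.

Lemma wt_sum_eq k k1 k2 :
  (l1 - k1%:R + (l2 - k2%:R) == l - k%:R) = (k1 + k2 == k + J)%N.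
Proof.
rewrite -(eqr_nat C) !natrD -subr_eq0 -[RHS]subr_eq0 -oppr_eq0.
by congr (_ == _); ring.
Qed.

Lemma qpow_wt k k1 k2 : (k1 + k2)%N = (k + J)%N ->
  qpow (2%:R * wt l1 k1) * qpow (2%:R * wt l2 k2) = qpow (2%:R * wt l k).
Proof.
move/eqP; rewrite -wt_sum_eq => /eqP <-; rewrite -qpowD; congr (Defs.qpow h _).
by ring.
Qed.

(** K separates the weights: two eigenvalues differ by a factor q^(2n), and q^(2n) = 1 would give
    [n] = 0, hence n = 0 by genericity. *)
Lemma qpow_wt_inj k k1 k2 :
  qpow (2%:R * wt l1 k1) * qpow (2%:R * wt l2 k2) = qpow (2%:R * wt l k) ->
  (k1 + k2)%N = (k + J)%N.
Proof.
pose n := (k + J)%:Z - (k1 + k2)%:Z.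
have -> : qpow (2%:R * wt l1 k1) * qpow (2%:R * wt l2 k2) =
    qpow (2%:R * wt l k) * (qpow n%:~R * qpow n%:~R).
  rewrite -!qpowD; congr (Defs.qpow h _).
  by rewrite /n rmorphB /= -!pmulrn !natrD; ring.
move/(congr1 ( *%R (qpow (2%:R * wt l k))^-1)).
rewrite mulKf ?mulVf ?qpow_neq0 // => qn1; apply/eqP.
have [n0|/qint_neq0] := eqVneq n 0; first by move: n0; rewrite /n; lia.
rewrite /Defs.qnum (_ : qpow n%:~R = qpow (- n%:~R)) ?subrr ?mul0r ?eqxx //.
by apply: (mulfI (qpow_neq0 h n%:~R)); rewrite qn1 -qpowD subrr qpow0.
Qed.

(** E kills v0: just two basis vectors reach a given coordinate, and their contributions are
    opposite. *)
Lemma racah_fock_E k1 k2 D : (k1 + k2).+1 = J ->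
  qnum k1.+1%:R * qpow (2%:R * wt l2 k2) * RF D 0 k1.+1 k2
  + qnum k2.+1%:R * RF D 0 k1 k2.+1 = 0.
Proof.
move=> kJ; have f0 := qfact_neq0 qnat_neq0.
rewrite !racah_fock0 ?(addSn, addnS) //; try exact: qnat_neq0.
rewrite !qfactS exprS.
have -> : qpow (l2 ^+ 2 - wt l2 k2 ^+ 2 - k1.+1%:R) =
  qpow (l2 ^+ 2 - wt l2 k2.+1 ^+ 2 - k1%:R) / qpow (2%:R * wt l2 k2).
  by rewrite -qpowN -qpowD -!natr1; congr (Defs.qpow h _); ring.
by field; rewrite !f0 !qnat_neq0 qpow_neq0.
Qed.

(** * Uniqueness of homomorphisms up to a scalar *)

Section Homomorphism.
Variable psi : {linear {malg C[nat]} -> {malg C[(nat * nat)%type]}}.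
Hypothesis psi_hom : hom psi.

Lemma hom_weight k k1 k2 : (k1 + k2)%N != (k + J)%N ->
  (psi << k >>)@_(k1, k2) = 0.
Proof.
move=> kJ; have [_ _ psiK _] := psi_hom << k >>.
move: psiK; rewrite /= vermaKU linearZ /=.
move/(congr1 (fun v => v@_(k1, k2))); rewrite mcoeffZ tensK_coef => /eqP.
rewrite eq_sym -subr_eq0 -mulrBl mulf_eq0 => /orP[|/eqP->//].
by rewrite subr_eq0 => /eqP/qpow_wt_inj kJ'; rewrite kJ' eqxx in kJ.
Qed.

Lemma hom_F k k1 k2 :
  qnum (l + wt l k) * (psi << k.+1 >>)@_(k1, k2) =
  F_coef h l1 l2 (fun i j => (psi << k >>)@_(i, j)) k1 k2.
Proof.
have [_ psiF _ _] := psi_hom << k >>.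
by rewrite -tensF_coef -[tensF _ _ _]psiF /= vermaFU linearZ mcoeffZ.
Qed.

Lemma hom_E k1 k2 :
  qnum k1.+1%:R * qpow (2%:R * wt l2 k2) * (psi << 0%N >>)@_(k1.+1, k2)
  + qnum k2.+1%:R * (psi << 0%N >>)@_(k1, k2.+1) = 0.
Proof.
have [psiE _ _ _] := psi_hom << 0%N >>.
rewrite -(@tensE_coef _ h l1) -[tensE _ _ _]psiE /= vermaEU linearZ mcoeffZ.
by rewrite subr0 subrr qnum0 mul0r.
Qed.

(** One coordinate of psi(e_l) fixes psi: E spreads it over the highest weight vector, then F over
    the module. *)
Lemma hom_coefE D : (psi << 0%N >>)@_(0%N, J) = RF D 0 0 J ->
  forall k k1 k2, (k1 + k2)%N = (k + J)%N ->
  (psi << k >>)@_(k1, k2) = RF D k k1 k2.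
Proof.
move=> psi0; apply: (F_coef_unique qwt_neq0); last 1 first.
- by move=> k k1 k2; apply: racah_fock_rec; [apply: qnat_neq0|apply: qwt_neq0].
(* The relation from E leads from (k1, k2 + 1) to (k1 + 1, k2), starting at (0, J). *)
- elim=> [|k1 IHk] k2 kJ; first by rewrite add0n in kJ; rewrite kJ.
  have := hom_E k1 k2; rewrite IHk; last by rewrite -kJ addnS.
  rewrite -(racah_fock_E D kJ) => /addIr; apply: mulfI.
  by rewrite mulf_neq0 ?qpow_neq0 ?qnat_neq0.
- by move=> k k1 k2 _; apply: hom_F.
Qed.

Lemma hom_norm D : (psi << 0%N >>)@_(0%N, J) = RF D 0 0 J ->
  tens_form (shapovalov h l1) (shapovalov h l2) (psi << 0%N >>) (psi << 0%N >>)
  = D ^+ 2 / Delta_sq h l1 l2 J.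
Proof.
move=> psi0; rewrite (@tens_form_shapovalov _ _ _ _ J) => [|k1 k2 kJ]; last first.
  by apply: hom_weight.
rewrite -racah_fock_norm; last 3 first.
- exact: qnat_neq0.
- exact: q2l1_neq0.
- exact: q2l2_neq0.
by apply: eq_asum => k1 k2 kJ; rewrite (hom_coefE psi0).
Qed.

Lemma hom_constant : exists D, (psi << 0%N >>)@_(0%N, J) = RF D 0 0 J.
Proof.
(* The Racah-Fock value at (0, J) for D = 1; the formula is linear in D. *)
pose u := sign_half R J * qpow (l2 ^+ 2 - wt l2 J ^+ 2 - 0%:R)
  / (qfact h 0 * qfact h J).
have u0 : u != 0.
  apply: mulf_neq0; first exact: mulf_neq0 (sign_half_neq0 _ _) (qpow_neq0 _ _).
  by rewrite invr_eq0; apply: mulf_neq0; apply: qfact_neq0; apply: qnat_neq0.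
exists ((psi << 0%N >>)@_(0%N, J) / u).
rewrite racah_fock0 //; last exact: qnat_neq0.
by rewrite expr0 mulr1 -[LHS](divfK u0) {2}/u; ring.
Qed.

End Homomorphism.

Lemma normalized_sqr psi D : normalized_embedding h l1 l2 J psi ->
  (psi << 0%N >>)@_(0%N, J) = RF D 0 0 J -> D ^+ 2 = Delta_sq h l1 l2 J.
Proof.
case=> psi_hom _ psi1 psi0; rewrite (hom_norm psi_hom psi0) in psi1.
by rewrite -[LHS](divfK Delta_sq_neq0) psi1 mul1r.
Qed.

(** * Construction of the embedding from a square root of Delta^2 *)

Section Existence.
Variable D : C.
Hypothesis DD : D ^+ 2 = Delta_sq h l1 l2 J.

Fixpoint emb_vec k : {malg C[(nat * nat)%type]} :=
  if k is k'.+1 then (qnum (l + wt l k'))^-1 *: tensF M1 M2 (emb_vec k')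
  else asum J (fun k1 k2 => RF D 0 k1 k2 *: << (k1, k2) >>).

Definition emb : {malg C[nat]} -> {malg C[(nat * nat)%type]} := linext emb_vec.
HB.instance Definition _ := GRing.Linear.on emb.

Lemma embU k : emb << k >> = emb_vec k.
Proof. exact: linextU. Qed.

Lemma emb_vec0 k1 k2 : (emb_vec 0)@_(k1, k2) =
  if (k1 + k2 == J)%N then RF D 0 k1 k2 else 0.
Proof. exact: (mcoeff_asum J (fun i j => RF D 0 i j)).
Qed.

Lemma emb_vec_weight k k1 k2 : (k1 + k2)%N != (k + J)%N ->
  (emb_vec k)@_(k1, k2) = 0.
Proof.
elim: k k1 k2 => [|k IHk] k1 k2 kJ; first by rewrite emb_vec0 ifN.
rewrite mcoeffZ tensF_coef /F_coef.
have -> : (if k1 is k0.+1 then qnum (l1 + wt l1 k0) * (emb_vec k)@_(k0, k2)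
   else 0) = 0.
  by case: k1 kJ => // k1 kJ; rewrite IHk ?mulr0 //; lia.
have -> : (if k2 is k0.+1 then qnum (l2 + wt l2 k0) * (emb_vec k)@_(k1, k0)
   else 0) = 0.
  by case: k2 kJ => // k2 kJ; rewrite IHk ?mulr0 //; lia.
by rewrite mulr0 addr0 mulr0.
Qed.

Lemma emb_K v : emb (vermaK h l v) = tensK M1 M2 (emb v).
Proof.
apply: (@linear_ext _ _ _ (emb \o vermaK h l) (tensK M1 M2 \o emb)) => k /=.
rewrite vermaKU linearZ /= embU; apply/malgP => -[k1 k2].
rewrite mcoeffZ tensK_coef; have [kJ|kJ] := eqVneq (k1 + k2)%N (k + J)%N.
  by rewrite (qpow_wt kJ).
by rewrite emb_vec_weight // !mulr0.
Qed.

Lemma emb_KV v : emb (vermaKV h l v) = tensKV M1 M2 (emb v).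
Proof.
by rewrite -[LHS](@tensKVK _ _ _ _ M1 M2) -emb_K vermaKKV.
Qed.

Lemma emb_F v : emb (vermaF h l v) = tensF M1 M2 (emb v).
Proof.
apply: (@linear_ext _ _ _ (emb \o vermaF h l) (tensF M1 M2 \o emb)) => k /=.
rewrite vermaFU linearZ /= !embU /= scalerA mulfV ?scale1r //.
exact: qwt_neq0.
Qed.

(* E commutes with emb on e_(l - k - 1), a multiple of F e_(l - k), because
   [E, F] does. *)
Lemma emb_E v : emb (vermaE h l v) = tensE M1 M2 (emb v).
Proof.
apply: (@linear_ext _ _ _ (emb \o vermaE h l) (tensE M1 M2 \o emb)) => k /=.
elim: k => [|k IHk].
  rewrite vermaEU subr0 subrr qnum0 scale0r linear0 embU.
  apply/malgP => -[k1 k2]; rewrite mcoeff0 tensE_coef !emb_vec0 addSn addnS.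
  by case: eqP => kJ; [rewrite racah_fock_E|rewrite !mulr0 addr0].
have EF : emb (vermaE h l (vermaF h l << k >>)) =
    tensE M1 M2 (tensF M1 M2 (emb << k >>)).
  have /eqP := tensE_F (qq_neq0 h) M1 M2 (emb << k >>).
  rewrite subr_eq => /eqP ->; have /eqP := vermaEF h l << k >>.
  rewrite subr_eq => /eqP ->.
  have embP a x y z x' y' z' : emb x = x' -> emb y = y' -> emb z = z' ->
      emb (a *: (x - y) + z) = a *: (x' - y') + z'.
    by move=> <- <- <-; rewrite linearP linearB.
  by apply: embP (emb_K _) (emb_KV _) _; apply: etrans (emb_F _) (congr1 _ IHk).
apply: (can_inj (scalerK (qwt_neq0 k))).
have embZ : emb (vermaE h l (vermaF h l << k >>)) =
    qnum (l + wt l k) *: emb (vermaE h l << k.+1 >>).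
  by rewrite vermaFU; apply: (linearZ_LR (emb \o vermaE h l)).
rewrite -embZ EF.
have -> : tensF M1 M2 (emb << k >>) = qnum (l + wt l k) *: emb << k.+1 >>.
  apply: etrans (esym (emb_F _)) _; rewrite vermaFU; exact: (linearZ_LR emb).
exact: (linearZ_LR (tensE M1 M2)).
Qed.

Lemma emb_hom : hom emb.
Proof.
move=> v; split; [exact: emb_E|exact: emb_F|exact: emb_K|exact: emb_KV].
Qed.

Lemma emb_coef k k1 k2 : (k1 + k2)%N = (k + J)%N ->
  (emb << k >>)@_(k1, k2) = RF D k k1 k2.
Proof.
apply: hom_coefE; first exact: emb_hom.
by rewrite [X in X@_ _](embU 0) emb_vec0 add0n eqxx.
Qed.

(** E maps the vector of index k + 1 to [k + 1] times that of index k, so a zero would propagate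
    down to v0, which is nonzero because D is. *)
Lemma emb_vec_neq0 k : emb_vec k != 0.
Proof.
elim: k => [|k]; last first.
  apply: contraNneq => vk0; apply/eqP.
  have := emb_E << k.+1 >>; rewrite vermaEU linearZ /= !embU vk0 linear0.
  have -> : l - wt l k.+1 = k.+1%:R by ring.
  by move/eqP; rewrite scaler_eq0 (negPf (qnat_neq0 k)) => /eqP.
apply/eqP => v0; have := emb_vec0 0 J; rewrite v0 mcoeff0 add0n eqxx.
have D0 : D != 0 by rewrite -sqrf_eq0 DD Delta_sq_neq0.
rewrite racah_fock0; last exact: qnat_neq0.
move/eqP; rewrite eq_sym; apply/negP.
rewrite expr0 mulr1; apply: mulf_neq0.
  apply: mulf_neq0 (D0).
  exact: mulf_neq0 (sign_half_neq0 _ _) (qpow_neq0 _ _).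
by rewrite invr_eq0; apply: mulf_neq0; apply: qfact_neq0; apply: qnat_neq0.
Qed.

(** The images of the basis vectors are nonzero with disjoint supports, since their weights differ;
    a coordinate with k1 + k2 = k + J sees only the k-th one. *)
Lemma emb_inj : injective emb.
Proof.
apply: raddf_inj => v ev0; apply/malgP => k; rewrite mcoeff0.
apply/eqP; apply: contraTT (emb_vec_neq0 k) => vk; rewrite negbK.
apply/eqP/malgP => -[k1 k2]; rewrite mcoeff0.
have [kJ|kJ] := eqVneq (k1 + k2)%N (k + J)%N; last exact: emb_vec_weight.
have := congr1 (@malg_coord _ _ (k1, k2)) (ev0 : linext emb_vec v = 0).
rewrite linear0 /linext linear_sum (bigD1_seq k) ?fset_uniq -?mcoeff_neq0 //=.
rewrite big1 => [|i ik].
  rewrite addr0 /malg_coord mcoeffZ => /eqP.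
  by rewrite mulf_eq0 (negPf vk) => /eqP.
rewrite /malg_coord mcoeffZ emb_vec_weight ?mulr0 //.
by rewrite kJ eqn_add2r eq_sym.
Qed.

Lemma emb_normalized : normalized_embedding h l1 l2 J emb.
Proof.
split; [exact: emb_hom|exact: emb_inj|].
have emb0 : (emb << 0%N >>)@_(0%N, J) = RF D 0 0 J by rewrite emb_coef.
by rewrite (hom_norm emb_hom emb0) DD divff // Delta_sq_neq0.
Qed.

End Existence.

End Embeddings.

Theorem theorem4p1 (R : realType) (h l1 l2 : R[i]) (J : nat)
  (hl1 : not_half_nat l1) (hl2 : not_half_nat l2)
  (hl12 : not_half_nat (l1 + l2)) (hq : generic h l1 l2) :
  let l := l1 + l2 - J%:R in
  let embedding (psi : {linear {malg R[i][nat]} ->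
                               {malg R[i][(nat * nat)%type]}}) :=
    normalized_embedding h l1 l2 J psi in
  let formulas (psi : {linear {malg R[i][nat]} ->
                              {malg R[i][(nat * nat)%type]}}) (D : R[i]) :=
    forall k k1 k2 : nat,
      (l1 - k1%:R) + (l2 - k2%:R) = l - k%:R ->
      q3j psi k k1 k2 = racah_fock h l1 l2 J D k k1 k2 /\
      q3j psi k k1 k2 = van_der_waerden h l1 l2 J D k k1 k2 in
  [/\ (* the normalized embedding exists and is unique up to sign *)
      (exists psi, embedding psi) /\
      (forall psi psi', embedding psi -> embedding psi' ->
         (forall v, psi' v = psi v) \/ (forall v, psi' v = - psi v)),
      (* the expansion defining the q3j-symbols *)
      (forall psi, embedding psi -> forall k : nat,
         psi << k >> =
         \sum_(k1 < (k + J).+1) \sum_(k2 < (k + J).+1 |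
            (l1 - k1%:R) + (l2 - k2%:R) == l - k%:R)
           q3j psi k k1 k2 *: tens << k1 : nat >> << k2 : nat >>),
      (* the formulas, the sign of psi being matched to the square root D *)
      (forall psi, embedding psi ->
         exists D, D ^+ 2 = Delta_sq h l1 l2 J /\ formulas psi D)
    & (forall D, D ^+ 2 = Delta_sq h l1 l2 J ->
         exists psi, embedding psi /\ formulas psi D)].
Proof.
move=> l embedding formulas.
have coef psi : embedding psi -> exists2 D, D ^+ 2 = Delta_sq h l1 l2 J &
    forall k k1 k2, (k1 + k2)%N = (k + J)%N ->
      (psi << k >>)@_(k1, k2) = racah_fock h l1 l2 J D k k1 k2.
  move=> psiE; have [psi_hom _ _] := psiE.
  have [D psi0] := hom_constant J hq psi; exists D.
    exact: (normalized_sqr hl1 hl2 hl12 hq psiE).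
  exact: (hom_coefE hl12 hq psi_hom).
have formulasP
    (psi : {linear {malg R[i][nat]} -> {malg R[i][(nat * nat)%type]}}) D :
    (forall k k1 k2, (k1 + k2)%N = (k + J)%N ->
      (psi << k >>)@_(k1, k2) = racah_fock h l1 l2 J D k k1 k2) ->
    formulas psi D.
  move=> psiD k k1 k2 /eqP; rewrite wt_sum_eq => /eqP kJ.
  rewrite van_der_waerden_racah_fock //; last 2 first.
  - exact: (qnat_neq0 hq).
  - exact: (qwt_neq0 J hl12 hq).
  by rewrite /q3j psiD.
have ex D : D ^+ 2 = Delta_sq h l1 l2 J ->
    exists psi, embedding psi /\ formulas psi D.
  move=> DD; exists (emb h l1 l2 J D); split.
    exact: (emb_normalized hl1 hl2 hl12 hq DD).
  by apply: formulasP => k k1 k2; apply: (emb_coef hl12 hq).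
split=> //; [split|..].
(* Any square root of Delta^2 yields an embedding. *)
- have [psi [psiE _]] := ex (sqrtC (Delta_sq h l1 l2 J)) (sqrtCK _).
  by exists psi.
- move=> psi psi' psiE psiE'; have [D DD psiD] := coef psi psiE.
  have [D' DD' psiD'] := coef psi' psiE'.
  have [psi_hom _ _] := psiE; have [psi_hom' _ _] := psiE'.
  (* Both constants square to Delta^2, so they agree up to sign, and the coordinates are linear in
     the constant. *)
  have /orP[/eqP DE|/eqP DE] : (D' == D) || (D' == - D).
    by rewrite -eqf_sqr DD DD'.
  - left; apply: linear_ext => k; apply/malgP => -[k1 k2].
    have [kJ|kJ] := eqVneq (k1 + k2)%N (k + J)%N.
      by rewrite psiD // psiD' // DE.
    by rewrite (hom_weight hq psi_hom) // (hom_weight hq psi_hom').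
  - right; apply: (@linear_ext _ _ _ psi' (\- psi)) => k.
    apply/malgP => -[k1 k2]; rewrite /= mcoeffN.
    have [kJ|kJ] := eqVneq (k1 + k2)%N (k + J)%N.
      by rewrite psiD // psiD' // DE /racah_fock mulrN mulNr.
    by rewrite (hom_weight hq psi_hom) // (hom_weight hq psi_hom') // oppr0.
- move=> psi [psi_hom _ _] k; have psiw := hom_weight hq psi_hom.
  rewrite [LHS](asum_basis (psiw k)); apply/esym/double_sum_asum => k1 k2.
  by rewrite wt_sum_eq tensUU.
- by move=> psi /coef[D DD psiD]; exists D; split=> //; apply: formulasP.
Qed.
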